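(* Let $d\ge 1$, let $\mathcal I$ be a finite set of labels, $\eta_0\in\mathcal I$, and let $p_0=\sum_{\eta\in\mathcal I} w_\eta p_\eta$ be a mixture distribution on $\mathbb R^d$ with weights $w_\eta\ge 0$, $\sum_{\eta} w_\eta=1$, $w_{\eta_0}>0$, where each $p_\eta$ is a probability density supported on a convex compact set $K_\eta\subseteq\mathbb R^d$ having at least one interior point, $K_\eta\cap K_{\eta'}=\emptyset$ for all $\eta\neq\eta'$, and $\inf_{x\in K_{\eta_0}}p_{\eta_0}(x)>0$. Let $T>0$ and let $\gamma\ge 1$. Then there exists $\kappa_0>0$ depending only on $(p_0,\gamma,T)$ such that for all $\kappa\in(0,1)$ with $\kappa\le\kappa_0$ the following holds. For any sequence $\{t_k\}_{k\ge 0}$ with $t_0=0$, $0\le t_k<t_{k+1}<T$, $t_k\to T$ as $k\to\infty$, and step sizes $\Delta_k=t_{k+1}-t_k$ satisfying $\Delta_k\le\kappa\min\{1,T-t_{k+1}\}$ for all $k$, and for any initialization $\hat x_{t_0}\in\mathbb R^d$, the random sequence defined by $$\hat x_{t_{k+1}}=e^{\Delta_k}\hat x_{t_k}+2(e^{\Delta_k}-1)\big(\nabla\log p_{T-t_k}(\hat x_{t_k})+\gamma\nabla\log p_{T-t_k}(\eta_0\mid\hat x_{t_k})\big)+\sqrt{e^{2\Delta_k}-1}\,Z_k,\qquad k\ge 0,$$ with $Z_0,Z_1,\dots$ i.i.d. $\mathcal N(0,I_d)$, satisfies almost surely $$\lim_{k\to\infty}\operatorname{dist}(\hat x_{t_k},K_{\eta_0})=0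 .$$
   Context: For $t>0$ set $\lambda_t=e^{-t}$, $\sigma_t=\sqrt{1-\lambda_t^2}$, $\phi_t(z)=(\sqrt{2\pi}\,\sigma_t)^{-d}\exp(-\|z\|^2/(2\sigma_t^2))$, and $$p_t(x)=\sum_{\eta\in\mathcal I}w_\eta\int p_\eta(u)\,\phi_t(x-\lambda_t u)\,\mathrm d u,\qquad p_t(\eta_0\mid x)=\frac{w_{\eta_0}\int p_{\eta_0}(u)\,\phi_t(x-\lambda_t u)\,\mathrm d u}{p_t(x)} .$$ All gradients are with respect to $x$. $\|\cdot\|$ is the Euclidean norm and $\operatorname{dist}(x,A)=\inf_{y\in A}\|x-y\|$. *)

(* Defs.v *)
From HB Require Import structures.
From mathcomp Require Import all_boot all_order all_algebra finmap.
From mathcomp Require Import all_classical all_reals all_analysis.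

Set Implicit Arguments.
Unset Strict Implicit.
Unset Printing Implicit Defensive.

Import Order.TTheory GRing.Theory Num.Theory.
Import numFieldNormedType.Exports.

Local Open Scope classical_set_scope.
Local Open Scope ring_scope.

(* The sigma-algebra on R^n generated by the coordinate maps, that is, the
   Borel sigma-algebra; same construction as the library's for n.-tuple T. *)
Section rV_measurable.
Context (R : realType) (n : nat).

Definition rV_coord (i : 'I_n) (x : 'rV[R]_n) : measurableTypeR R := x ord0 i.

Let rV_set0 : g_sigma_preimage rV_coord set0.
Proof. exact: sigma_algebra0. Qed.

Let rV_setC A : g_sigma_preimage rV_coord A -> g_sigma_preimage rV_coord (~` A).
Proof. exact: sigma_algebraC. Qed.

Let rV_bigcup (F : (set 'rV[R]_n)^nat) :
  (forall i, g_sigma_preimage rV_coord (F i)) ->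
  g_sigma_preimage rV_coord (\bigcup_i (F i)).
Proof. exact: sigma_algebra_bigcup. Qed.

HB.instance Definition _ := @isMeasurable.Build default_measure_display
  'rV[R]_n (g_sigma_preimage rV_coord) rV_set0 rV_setC rV_bigcup.

Lemma measurable_rV_coord (i : 'I_n) : measurable_fun [set: 'rV[R]_n] (rV_coord i).
Proof.
move=> _ Y mY; rewrite setTI; apply: sub_sigma_algebra => /=.
rewrite -bigcup_seq/=; exists i => /=; first by rewrite mem_index_enum.
by exists Y => //; rewrite setTI.
Qed.

Lemma measurable_fun_rVP d (T : measurableType d) (f : T -> 'rV[R]_n) :
  (forall i, measurable_fun [set: T] (rV_coord i \o f)) ->
  measurable_fun [set: T] f.
Proof.
move=> mf.
have sub : (g_sigma_preimage (fun i => rV_coord i \o f) `<=` measurable).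
  apply: smallest_sub; first exact: sigma_algebra_measurable.
  move: mf; case: (posnP n) => [n0|n0].
    move=> _; rewrite big1// => i; by have := ltn_ord i; rewrite {2}n0.
  move=> mf A; rewrite -bigcup_seq/= => -[i _ [B mB <-]].
  exact: mf.
rewrite g_sigma_preimage_comp in sub.
by move=> _ A mA; apply: sub; exists A.
Qed.

End rV_measurable.

Section lebesgue_rV.
Context (R : realType).

Definition rV_cons n (z : measurableTypeR R * 'rV[R]_n) : 'rV[R]_n.+1 :=
  row_mx (z.1%:M : 'rV[R]_1) z.2.

Definition rV_uncons n (x : 'rV[R]_n.+1) : measurableTypeR R * 'rV[R]_n :=
  (x ord0 ord0, \row_i x ord0 (lift ord0 i)).

Lemma rV_cons0 n (z : measurableTypeR R * 'rV[R]_n) : rV_cons z ord0 ord0 = z.1.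
Proof.
transitivity (rV_cons z ord0 (lshift n (ord0 : 'I_1))).
  by congr (fun_of_matrix _ _ _); exact/val_inj.
by rewrite /rV_cons (row_mxEl (z.1%:M : 'rV[R]_1)) !mxE eqxx mulr1n.
Qed.

Lemma rV_consS n (z : measurableTypeR R * 'rV[R]_n) i :
  rV_cons z ord0 (lift ord0 i) = z.2 ord0 i.
Proof.
transitivity (rV_cons z ord0 (rshift 1 i)).
  by congr (fun_of_matrix _ _ _); exact/val_inj.
by rewrite /rV_cons (row_mxEr (z.1%:M : 'rV[R]_1)).
Qed.

Lemma rV_consK n : cancel (@rV_cons n) (@rV_uncons n).
Proof.
move=> z; rewrite /rV_uncons rV_cons0 [z in RHS]surjective_pairing; congr pair.
by apply/rowP => i; rewrite mxE rV_consS.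
Qed.

Lemma measurable_rV_cons n : measurable_fun setT (@rV_cons n).
Proof.
apply: measurable_fun_rVP => i; case: (unliftP ord0 i) => [j|] ->.
  rewrite (_ : _ \o _ = @rV_coord R n j \o snd).
    by apply: measurableT_comp => //; exact: measurable_rV_coord.
  by apply/funext => z; rewrite /= /rV_coord rV_consS.
rewrite (_ : _ \o _ = fst); first exact: measurable_fst.
by apply/funext => z; rewrite /= /rV_coord rV_cons0.
Qed.

Lemma measurable_rV_uncons n : measurable_fun setT (@rV_uncons n).
Proof.
apply: measurable_fun_pair => /=; first exact: measurable_rV_coord.
apply: measurable_fun_rVP => i.
rewrite (_ : _ \o _ = @rV_coord R n.+1 (lift ord0 i)).
  exact: measurable_rV_coord.
by apply/funext => x; rewrite /= /rV_coord mxE.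
Qed.

HB.instance Definition _ n :=
  isMeasurableFun.Build _ _ _ _ (@rV_cons n) (@measurable_rV_cons n).

Section step.
Context (n : nat) (m : {sigma_finite_measure set 'rV[R]_n -> \bar R}).

Definition lebesgue_rV_step : set 'rV[R]_n.+1 -> \bar R :=
  pushforward ((@lebesgue_measure R) \x m)%E (@rV_cons n).

Let step0 : lebesgue_rV_step set0 = 0%E.
Proof. exact: measure0. Qed.

Let step_ge0 A : (0 <= lebesgue_rV_step A)%E.
Proof. exact: measure_ge0. Qed.

Let step_sigma_additive : semi_sigma_additive lebesgue_rV_step.
Proof.
exact: (@measure_semi_sigma_additive _ _ _
  (pushforward ((@lebesgue_measure R) \x m)%E (@rV_cons n))).
Qed.

HB.instance Definition _ :=
  isMeasure.Build _ _ _ lebesgue_rV_step step0 step_ge0 step_sigma_additive.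

(* The library's sigma-finite instance on m1 \x m2 is not inferred here: the one
   for a pair of subprobabilities shadows it, hence the direct proof. *)
Let sigma_finite_step : sigma_finite setT lebesgue_rV_step.
Proof.
have [F FT Ffin] : sigma_finite setT ((@lebesgue_measure R) \x m)%E.
  have /sigma_finiteP[F [TF ndF Foo]] := sigma_finiteT (@lebesgue_measure R).
  have /sigma_finiteP[G [TG ndG Goo]] := sigma_finiteT m.
  exists (fun k => F k `*` G k).
    rewrite -setXTT TF TG predeqE => -[x y]; split.
      move=> [/= [i _ Fix] [j _ Gjy]]; exists (maxn i j) => //; split.
      - by move: x Fix; exact/subsetPset/ndF/leq_maxl.
      - by move: y Gjy; exact/subsetPset/ndG/leq_maxr.
    by move=> [k _ []/= ? ?]; split; exists k.
  move=> k; have [? ?] := Foo k; have [? ?] := Goo k.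
  split; first exact: measurableX.
  by rewrite product_measure1E// lte_mul_pinfty// ge0_fin_numE.
exists (fun k => @rV_uncons n @^-1` F k).
  by rewrite -preimage_bigcup -FT preimage_setT.
move=> k; have [mF Foo] := Ffin k; split.
  by rewrite -[X in measurable X]setTI; exact: measurable_rV_uncons.
rewrite /lebesgue_rV_step /pushforward -comp_preimage.
by rewrite (_ : _ \o _ = id) //; apply/funext => z; exact: rV_consK.
Qed.

HB.instance Definition _ :=
  Measure_isSigmaFinite.Build _ _ _ lebesgue_rV_step sigma_finite_step.

End step.

(* n-fold product of the one-dimensional Lebesgue measure; see
   lebesgue_rV_box for its values on boxes. *)
Fixpoint lebesgue_rV n : {sigma_finite_measure set 'rV[R]_n -> \bar R} :=
  match n with
  | 0 => \d_(0 : 'rV[R]_0)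
  | n'.+1 => lebesgue_rV_step (lebesgue_rV n')
  end.

Lemma lebesgue_rV_box n (A : 'I_n -> set (measurableTypeR R)) :
  (forall i, measurable (A i)) ->
  lebesgue_rV n [set x | forall i, A i (x ord0 i)] =
  (\prod_(i < n) lebesgue_measure (A i))%E.
Proof.
elim: n A => [|n IH] A mA.
  by rewrite big_ord0 /= diracE mem_set//= => -[].
rewrite big_ord_recl -(IH (fun i => A (lift ord0 i)))//.
rewrite /= /lebesgue_rV_step /pushforward -product_measure1E//; last first.
  rewrite [X in measurable X](_ : _ = \bigcap_(i in [set: 'I_n])
                           (@rV_coord R n i @^-1` A (lift ord0 i))).
    apply: fin_bigcap_measurable => // i _.
    by rewrite -[X in measurable X]setTI; exact: measurable_rV_coord.
  by apply/seteqP; split => x /= Ax i; [move=> _|]; exact: Ax.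
congr (_ _); apply/seteqP; split => -[a x] /=.
  move=> Aax; split => [|i] /=; first by have := Aax ord0; rewrite rV_cons0.
  by have := Aax (lift ord0 i); rewrite rV_consS.
move=> [/= Aa Ax] i; case: (unliftP ord0 i) => [j|] ->.
  by rewrite rV_consS; exact: Ax.
by rewrite rV_cons0.
Qed.

End lebesgue_rV.
Arguments lebesgue_rV {R} n.

Section euclidean.
Context (R : realType) (d : nat).
Implicit Types (x : 'rV[R]_d) (A : set 'rV[R]_d) (f : 'rV[R]_d -> R).

(* The library's `|x| on row vectors is the sup norm. *)
Definition enorm x : R := Num.sqrt (\sum_(i < d) x ord0 i ^+ 2).

Definition dist_set x A : R := inf [set enorm (x - y) | y in A].

Definition gradient f x : 'rV[R]_d := \row_(i < d) 'D_(delta_mx ord0 i) f x.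

Definition is_pdf f :=
  [/\ measurable_fun setT f, forall u, 0 <= f u
    & (\int[lebesgue_rV d]_u (f u)%:E = 1)%E].

End euclidean.

Section diffusion.
Context (R : realType) (d : nat) (I : finType).
Context (w : I -> R) (p : I -> 'rV[R]_d -> R).
Implicit Types (t : R) (x z : 'rV[R]_d) (eta : I).

Definition lambda_ t : R := expR (- t).

Definition sigma_ t : R := Num.sqrt (1 - lambda_ t ^+ 2).

(* Density of N(0, s^2 I_d). *)
Definition isotropic_gauss_pdf (s : R) z : R :=
  (Num.sqrt (2 * pi) * s) ^- d * expR (- (enorm z ^+ 2 / (2 * s ^+ 2))).

Definition phi_ t z : R := isotropic_gauss_pdf (sigma_ t) z.

Definition noised_component t eta x : R :=
  \int[lebesgue_rV d]_u (p eta u * phi_ t (x - lambda_ t *: u)).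

Definition noised_mixture t x : R := \sum_eta w eta * noised_component t eta x.

Definition noised_posterior t eta x : R :=
  w eta * noised_component t eta x / noised_mixture t x.

End diffusion.

Section gaussian_noise.
Context (R : realType) (d : nat) (disp : measure_display).
Context (Omega : measurableType disp) (P : probability Omega R).
Implicit Type Z : nat -> {RV P >-> 'rV[R]_d}.

Definition standard_gaussian (X : {RV P >-> 'rV[R]_d}) :=
  forall A : set 'rV[R]_d, measurable A ->
    distribution P X A =
      (\int[lebesgue_rV d]_(z in A) (isotropic_gauss_pdf 1 z)%:E)%E.

Definition mutually_independent Z :=
  forall (J : {fset nat}) (A : nat -> set 'rV[R]_d),
    (forall k, measurable (A k)) ->
    P (\bigcap_(k in [set` J]) (Z k @^-1` A k)) =
      (\prod_(k <- J) P (Z k @^-1` A k))%E.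

End gaussian_noise.

(* Main.v *)
(* Write s = T - t_k, lam = e^-s, sig^2 = 1 - lam^2.  By Tweedie's formula the
   gradients of log p_s and of log p_s(eta0 | .) are expressed by the posterior
   means m of the mixture and m0 of the component eta0, and the recursion reads
     x' = x + a (gamma (lam m0 - x) + (gamma - 1) (x - lam m) + sig^2/2 x) + noise
   with a = 2 (e^Delta - 1) / sig^2, which lies between Delta/s and C kappa.
   The squared distance D^2 to K_eta0 is a Lyapunov function.  Let P be the
   projection of x: <x - P, m0 - P> <= 0 because m0 is an average over K_eta0,
   while |x - lam m| <= D + o(1) uniformly in x as s -> 0.  The latter holds since
     |x - lam m|^2 <= E |x - lam u|^2 <= - 2 sig^2 log E_prior e^(-|x - lam u|^2 / (2 sig^2))
   by Jensen, and p_0 is bounded below near P on a subset of K_eta0 of definite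
   volume.  Hence <x - P, drift> <= - D^2 + D o(1), D^2 contracts by 1 - a up to
   a o(1), and the product of the 1 - a_k vanishes as s_{k+1}/s_k >= 1 - a_k.
   The noises have summable variances, so by Kolmogorov's theorem their sum
   converges almost surely; adding its tail to the iterate removes the noise from
   the recursion. *)

Require Import Defs.
From HB Require Import structures.
From mathcomp Require Import all_boot all_order all_algebra finmap.
From mathcomp Require Import all_classical all_reals all_analysis.
From mathcomp Require Import measurable_realfun ring lra.

Set Implicit Arguments.
Unset Strict Implicit.
Unset Printing Implicit Defensive.

Import Order.TTheory GRing.Theory Num.Theory.
Import numFieldNormedType.Exports.

Local Open Scope classical_set_scope.
Local Open Scope ring_scope.

(** * Euclidean geometry *)

(** The sign of the drift rests on one cancellation: the obtuse angle at the projection makes the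
    guidance towards [m0] contribute [- gamma D^2], Cauchy-Schwarz makes the term in [m] contribute
    at most [(gamma - 1) D^2], and one [- D^2] survives whatever the other components do. No bound
    on the iterates is ever proved: the error terms are controlled by [D] and by o(1) uniformly in
    the iterate, so the contraction takes over from wherever the path stands once [s] is small.
    Randomness is confined to the convergence of the noise series; afterwards the path is fixed. The
    price of absorbing the noise tail is that the projection is taken at the shifted iterate and the
    drift at the original one. A point [P] of the boundary of [K_eta0] may sit in a thin corner; the
    definite volume comes from convexity, as the image of a fixed box under a homothety centred at
    [P]. The threshold is [kappa0 = 1 / (32 gamma^2 e^3)]: [e^3] bounds [a / kappa], and
    [32 gamma^2 a <= 1] keeps the second-order term of the squared distance below a quarter of
    [a D^2], up to o(1). *)

Section euclidean_geometry.
Context (R : realType) (d : nat).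
Implicit Types (x y z u v : 'rV[R]_d) (a : R).

Definition dotv x y : R := \sum_(i < d) x ord0 i * y ord0 i.

Lemma dotvC x y : dotv x y = dotv y x.
Proof. by apply: eq_bigr => i _; rewrite mulrC. Qed.

Lemma dotvDl x y z : dotv (x + y) z = dotv x z + dotv y z.
Proof. by rewrite -big_split; apply: eq_bigr => i _; rewrite mxE mulrDl. Qed.

Lemma dotvZl a x z : dotv (a *: x) z = a * dotv x z.
Proof. by rewrite mulr_sumr; apply: eq_bigr => i _; rewrite mxE mulrA. Qed.

Lemma dotvNl x z : dotv (- x) z = - dotv x z.
Proof. by rewrite -scaleN1r dotvZl mulN1r. Qed.

Lemma dotvDr x y z : dotv z (x + y) = dotv z x + dotv z y.
Proof. by rewrite dotvC dotvDl !(dotvC z). Qed.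

Lemma dotvZr a x z : dotv z (a *: x) = a * dotv z x.
Proof. by rewrite dotvC dotvZl dotvC. Qed.

Lemma dotvNr x z : dotv z (- x) = - dotv z x.
Proof. by rewrite dotvC dotvNl dotvC. Qed.

Definition dotvE := (dotvDl, dotvDr, dotvNl, dotvNr, dotvZl, dotvZr).

Lemma enorm_ge0 x : 0 <= enorm x.
Proof. exact: sqrtr_ge0. Qed.

Lemma enorm_sqr x : enorm x ^+ 2 = dotv x x.
Proof.
rewrite sqr_sqrtr; first by apply: eq_bigr => i _; rewrite expr2.
by apply: sumr_ge0 => i _; exact: sqr_ge0.
Qed.

Lemma dotv_ge0 x : 0 <= dotv x x.
Proof. by rewrite -enorm_sqr sqr_ge0. Qed.

Lemma dotv_eq0 x : dotv x x = 0 -> x = 0.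
Proof.
move=> /psumr_eq0P x0; apply/rowP => i; rewrite mxE.
apply/eqP; rewrite -sqrf_eq0 expr2 x0// => j _.
by rewrite -expr2 sqr_ge0.
Qed.

Lemma cauchy_schwarz_dotv x y : dotv x y <= enorm x * enorm y.
Proof.
have [x0|xn0] := eqVneq (enorm x) 0.
  have -> : x = 0 by apply: dotv_eq0; rewrite -enorm_sqr x0 expr0n.
  rewrite /dotv big1 ?mulr_ge0 ?enorm_ge0// => i _.
  by rewrite mxE mul0r.
have x0 : 0 < enorm x by rewrite lt_neqAle eq_sym xn0 enorm_ge0.
have [y0|yn0] := eqVneq (enorm y) 0.
  have -> : y = 0 by apply: dotv_eq0; rewrite -enorm_sqr y0 expr0n.
  rewrite /dotv big1 ?mulr_ge0 ?enorm_ge0// => i _.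
  by rewrite mxE mulr0.
have y0 : 0 < enorm y by rewrite lt_neqAle eq_sym yn0 enorm_ge0.
have := dotv_ge0 (enorm y *: x - enorm x *: y).
rewrite !dotvE (dotvC y x) -!enorm_sqr.
have := mulr_gt0 x0 y0; nra.
Qed.

Lemma enormZ a x : enorm (a *: x) = `|a| * enorm x.
Proof.
apply/eqP; rewrite -(@eqrXn2 _ 2)// ?mulr_ge0 ?enorm_ge0//.
by rewrite exprMn !enorm_sqr !dotvE real_normK ?num_real// mulrA.
Qed.

Lemma enormN x : enorm (- x) = enorm x.
Proof. by rewrite -scaleN1r enormZ normrN1 mul1r. Qed.

Lemma enormBC x y : enorm (x - y) = enorm (y - x).
Proof. by rewrite -opprB enormN. Qed.

Lemma enormD x y : enorm (x + y) <= enorm x + enorm y.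
Proof.
rewrite -(@ler_pXn2r _ 2) ?nnegrE ?addr_ge0 ?enorm_ge0//.
rewrite sqrrD !enorm_sqr !dotvE (dotvC y x).
have := cauchy_schwarz_dotv x y; lra.
Qed.

Lemma enormB_le x y : enorm (x - y) <= enorm x + enorm y.
Proof. by rewrite (le_trans (enormD _ _))// enormN. Qed.

Lemma coord_le_enorm x i : `|x ord0 i| <= enorm x.
Proof.
rewrite -(@ler_pXn2r _ 2) ?nnegrE ?enorm_ge0// enorm_sqr real_normK ?num_real//.
rewrite /dotv (bigD1 i)//= -expr2 lerDl sumr_ge0// => j _.
by rewrite -expr2 sqr_ge0.
Qed.

Lemma enorm_le_sum x : enorm x <= \sum_(i < d) `|x ord0 i|.
Proof.
rewrite -(@ler_pXn2r _ 2) ?nnegrE ?enorm_ge0 ?sumr_ge0//.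
rewrite enorm_sqr expr2 mulr_suml; apply: ler_sum => i _.
rewrite (le_trans (ler_norm _))// normrM ler_wpM2l// (bigD1 i)//= lerDl.
exact: sumr_ge0.
Qed.

Lemma continuous_enorm : continuous (@enorm R d).
Proof.
move=> x; apply: (@continuous_comp _ _ _
  (fun y : 'rV[R]_d => \sum_(i < d) y ord0 i ^+ 2) Num.sqrt); last first.
  exact: sqrt_continuous.
apply: (@cvg_big R^o 'I_d +%R 0 predT) => [||i _].
- exact: (@add_continuous R^o).
- exact: nbhs_filter.
have c : (fun y : 'rV[R]_d => y ord0 i) y @[y --> x] --> x ord0 i.
  exact: coord_continuous.
exact: (cvgM c c).
Qed.

Definition is_proj (K : set 'rV[R]_d) x P :=
  K P /\ forall z, K z -> enorm (x - P) <= enorm (x - z).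

Lemma exists_proj (K : set 'rV[R]_d) x :
  compact K -> K !=set0 -> exists P, is_proj K x P.
Proof.
move=> cK K0.
have [|P] := @EVT_min_rV _ _ (fun z => enorm (x - z)) _ K0 cK.
  apply: continuous_subspaceT => z.
  have c : (x - u) @[u --> z] --> x - z.
    exact: (@cvgB R 'rV[R]_d 'rV[R]_d (nbhs z) _ (cst x) id x z (cvg_cst x) cvg_id).
  exact: (@cvg_comp _ _ _ (fun u => x - u) (@enorm R d) _ _ _ c (@continuous_enorm _)).
rewrite inE => KP hP; exists P; split=> // z Kz; apply: hP.
by rewrite inE.
Qed.

Lemma convex_setP (K : set 'rV[R]_d) x y a : convex_set K -> K x -> K y ->
  0 <= a -> a <= 1 -> K (a *: x + (1 - a) *: y).
Proof.
move=> cK Kx Ky a0 a1.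
pose l : {i01 R} := Itv01 a0 a1.
have := cK x y l; rewrite !inE => /(_ Kx Ky).
by rewrite /conv/=.
Qed.

(** Were the angle at [P] acute, a short move from [P] towards [z], which stays in [K] by convexity,
    would come closer to [x]. *)
Lemma proj_obtuse (K : set 'rV[R]_d) x P z : convex_set K ->
  is_proj K x P -> K z -> dotv (x - P) (z - P) <= 0.
Proof.
move=> cK [KP hP] Kz; rewrite leNgt; apply/negP => pos.
set q := dotv (z - P) (z - P).
set c := dotv _ _ in pos.
have q0 : 0 <= q := dotv_ge0 _.
(* The move changes the squared distance by [- 2 a c + a^2 q], negative as soon as [a q < 2 c];
   [q + 1] avoids a division by zero. *)
pose a := Num.min 1 (c / (q + 1)).
have a0 : 0 < a by rewrite lt_min ltr01 divr_gt0// ltr_wpDl.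
have a1 : a <= 1 by rewrite ge_min lexx.
have aq : a * (q + 1) <= c.
  by rewrite -ler_pdivlMr ?ltr_wpDl// ge_min lexx orbT.
have := hP _ (convex_setP cK Kz KP (ltW a0) a1).
rewrite -(@ler_pXn2r _ 2) ?nnegrE ?enorm_ge0// !enorm_sqr.
have -> : x - (a *: z + (1 - a) *: P) = (x - P) - a *: (z - P).
  by apply/rowP => i; rewrite !mxE; ring.
set e := x - P; set f := z - P; rewrite 3!dotvE.
rewrite !(dotvNl, dotvNr, dotvZl, dotvZr) -/e -/f.
rewrite (dotvC f e) -/c -/q.
nra.
Qed.

Lemma dist_set_ge0 (K : set 'rV[R]_d) x : K !=set0 -> 0 <= dist_set x K.
Proof.
move=> [z Kz]; apply: lb_le_inf; first by exists (enorm (x - z)); exists z.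
by move=> _ [y _ <-]; exact: enorm_ge0.
Qed.

Lemma dist_set_le (K : set 'rV[R]_d) x z : K z -> dist_set x K <= enorm (x - z).
Proof.
move=> Kz; apply: ge_inf; last by exists z.
by exists 0 => _ [y _ <-]; exact: enorm_ge0.
Qed.

End euclidean_geometry.

(** * The guided recursion without noise *)

Section deterministic_contraction.
Context (R : realType).

(** No product has to be estimated: [s] satisfies [(1 - a k) * s k <= s k.+1], and the constant
    [e / 2] is fixed by the recursion with [eta = e / 2], so [e / 2 + B * s] stays above [u] once it
    is above it at [N]. *)
Lemma contraction_cvg0 (u a s : nat -> R) :
  (forall k, 0 <= u k) -> (forall k, 0 < s k) -> (forall k, a k <= 1) ->
  (forall k, 1 - a k <= s k.+1 / s k) -> s @ \oo --> 0 ->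
  (forall eta, 0 < eta ->
    \forall k \near \oo, u k.+1 <= (1 - a k) * u k + a k * eta) ->
  u @ \oo --> 0.
Proof.
move=> u0 s0 a1 as_ scvg h; apply/cvgrPdist_le => e e0.
have e20 : 0 < e / 2 by rewrite divr_gt0.
have [N _ hN] := h _ e20.
pose B := u N / s N.
have B0 : 0 <= B by rewrite divr_ge0// ltW.
have bound n : u (N + n)%N <= e / 2 + B * s (N + n)%N.
  elim: n => [|n IH].
    by rewrite addn0 divfK ?gt_eqF// lerDr ltW.
  rewrite addnS; apply: (le_trans (hN _ (leq_addr _ _))).
  have := as_ (N + n)%N; rewrite ler_pdivlMr// => as1.
  have a1' : 0 <= 1 - a (N + n)%N by rewrite subr_ge0.
  have := ler_wpM2l a1' IH; have := ler_wpM2l B0 as1; lra.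
have : \forall k \near \oo, B * s k <= e / 2.
  have : (fun k => B * s k) @ \oo --> B * 0 by apply: cvgMr.
  rewrite mulr0 => /cvgrPdist_le/(_ _ e20); apply: filterS => k.
  by rewrite sub0r normrN; apply: le_trans; exact: ler_norm.
move=> [N' _ hN']; exists (N + N')%N => // k /= Nk.
rewrite sub0r normrN ger0_norm//.
have [le1 le2] : (N <= k)%N /\ (N' <= k)%N.
  by split; apply: leq_trans Nk; rewrite ?leq_addr ?leq_addl.
have := bound (k - N)%N; rewrite subnKC//.
have := hN' _ le2 => /=; lra.
Qed.

(* In the trajectory, [x] is the iterate and [y] is [x] plus all the noise still
   to come, so that [y] moves by the drift at [x] only; [P] is the projection of
   [y], and [mu0], [mu] are the posterior means for the target component and for
   the whole mixture. *)
Lemma guided_step (d : nat) (gamma M lam v a eps : R)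
    (x y P mu0 mu : 'rV[R]_d) (C := gamma * M + 4 * gamma + M + 1) :
  1 <= gamma -> 0 <= M -> 0 < lam <= 1 -> 1 - lam <= eps -> 0 <= v <= eps ->
  eps <= 8^-1 -> 0 <= a -> 32 * gamma ^+ 2 * a <= 1 ->
  enorm P <= M -> enorm mu0 <= M -> dotv (y - P) (mu0 - P) <= 0 ->
  enorm (x - y) <= eps ->
  enorm (x - lam *: mu0) <= enorm (y - P) + 2 * eps ->
  enorm (x - lam *: mu) <= enorm (y - P) + 2 * eps ->
  enorm (y + a *: (gamma *: (lam *: mu0 - x) + (gamma - 1) *: (x - lam *: mu)
                   + v *: x) - P) ^+ 2
    <= (1 - a) * enorm (y - P) ^+ 2 + a * (4 * C ^+ 2 * eps ^+ 2).
Proof.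
move=> g1 M0 /andP[l0 l1] leps /andP[v0 veps] eps8 a0 a32 PM m0M obt xy xm0 xm.
set b := _ + _ + v *: x.
set e := y - P; set D := enorm e.
have D0 : 0 <= D := enorm_ge0 _.
have eps0 : 0 <= eps by lra.
have xD : enorm x <= D + M + eps.
  have -> : x = (x - y) + (e + P) by apply/rowP => i; rewrite !mxE; ring.
  have := enormD (x - y) (e + P); have := enormD e P; rewrite -/D; lra.
(* The main terms add up to [- gamma D^2 + (gamma - 1) D^2 = - D^2]. The eighth given away pays for
   the dilation term, since [v <= eps <= 8^-1]. *)
have eb : dotv e b <= - (7 / 8) * D ^+ 2 + C * eps * D.
  have -> : b = gamma *: ((mu0 - P) - (1 - lam) *: mu0 - e + (y - x))
                + (gamma - 1) *: (x - lam *: mu) + v *: x.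
    by apply/rowP => i; rewrite !mxE; ring.
  have expand (f A B F : 'rV[R]_d) :
      dotv f (gamma *: (A - (1 - lam) *: mu0 - f + B) + (gamma - 1) *: F + v *: x)
      = gamma * (dotv f A - (1 - lam) * dotv f mu0 - dotv f f + dotv f B)
        + (gamma - 1) * dotv f F + v * dotv f x.
    by rewrite !dotvE.
  rewrite expand -enorm_sqr -/D.
  have h1 : dotv e (x - lam *: mu) <= D * (D + 2 * eps).
    by apply: (le_trans (cauchy_schwarz_dotv _ _)); rewrite ler_wpM2l.
  have h2 : dotv e x <= D * (D + M + eps).
    by apply: (le_trans (cauchy_schwarz_dotv _ _)); rewrite ler_wpM2l.
  have h3 : - dotv e mu0 <= D * M.
    by rewrite -dotvNr; apply: (le_trans (cauchy_schwarz_dotv _ _));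
      rewrite ler_wpM2l// enormN.
  have h4 : dotv e (y - x) <= D * eps.
    by apply: (le_trans (cauchy_schwarz_dotv _ _)); rewrite ler_wpM2l// enormBC.
  have k1 : (gamma - 1) * dotv e (x - lam *: mu) <=
            (gamma - 1) * (D * (D + 2 * eps)) by apply: ler_wpM2l => //; lra.
  have DM : 0 <= D * M by rewrite mulr_ge0.
  have k2 : v * dotv e x <= eps * (D * (D + M + eps)).
    apply: (@le_trans _ _ (v * (D * (D + M + eps)))); first exact: ler_wpM2l.
    by apply: ler_wpM2r => //; apply: mulr_ge0 => //; lra.
  have k3 : (1 - lam) * - dotv e mu0 <= eps * (D * M).
    apply: (@le_trans _ _ ((1 - lam) * (D * M))); last exact: ler_wpM2r.
    by apply: ler_wpM2l => //; lra.
  set inner := dotv e (mu0 - P) + _ + _ + _.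
  have k4 : inner <= eps * (D * M) - D ^+ 2 + D * eps.
    by rewrite /inner; move: obt; rewrite -/e; lra.
  have k5 : gamma * inner <= gamma * (eps * (D * M) - D ^+ 2 + D * eps).
    by apply: ler_wpM2l => //; lra.
  have eD : 0 <= eps * D by rewrite mulr_ge0.
  have eDD : eps * D ^+ 2 <= 8^-1 * D ^+ 2 by rewrite ler_wpM2r ?sqr_ge0.
  have eeD : eps * (eps * D) <= 8^-1 * (eps * D) by rewrite ler_wpM2r.
  have eDg : eps * D <= gamma * (eps * D) by rewrite ler_peMl.
  rewrite /C; nra.
(* Both guidance terms have norm about [D] times their weight, [2 gamma - 1] in all. The closeness
   of [x] to [lam *: mu0] serves here, for the second-order term. *)
have nb : enorm b <= 2 * gamma * D + C * eps.
  have k0 : enorm b <= gamma * (D + 2 * eps) + (gamma - 1) * (D + 2 * eps)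
                       + eps * (D + M + eps).
    rewrite /b; apply: (le_trans (enormD _ _)); apply: lerD.
      apply: (le_trans (enormD _ _)); rewrite !enormZ (enormBC (_ *: mu0)).
      rewrite !ger0_norm ?subr_ge0//; last lra.
      by apply: lerD; apply: ler_wpM2l => //; lra.
    by rewrite enormZ ger0_norm//; apply: ler_pM => //; exact: enorm_ge0.
  have eD : eps * D <= 8^-1 * D by rewrite ler_wpM2r.
  have ee : eps * eps <= 8^-1 * eps by rewrite ler_wpM2r.
  have eM : 0 <= gamma * (M * eps) by rewrite !mulr_ge0//; lra.
  have eg : eps <= gamma * eps by rewrite ler_peMl.
  rewrite /C; nra.
have C0 : 0 <= C * eps.
  by rewrite mulr_ge0// /C !addr_ge0// ?mulr_ge0//; lra.
have nb2 : enorm b ^+ 2 <= 8 * gamma ^+ 2 * D ^+ 2 + 2 * (C * eps) ^+ 2.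
  apply: (@le_trans _ _ ((2 * gamma * D + C * eps) ^+ 2)).
    by rewrite ler_pXn2r ?nnegrE ?enorm_ge0// addr_ge0// !mulr_ge0//; lra.
  have := sqr_ge0 (2 * gamma * D - C * eps); nra.
have -> : y + a *: b - P = e + a *: b by apply/rowP => i; rewrite !mxE; ring.
have expand (f h : 'rV[R]_d) :
    enorm (f + a *: h) ^+ 2 = enorm f ^+ 2 + 2 * a * dotv f h + a ^+ 2 * enorm h ^+ 2.
  by rewrite !enorm_sqr !dotvE (dotvC h f); ring.
rewrite expand -/D.
(* Budget for [a D^2]: [- 7/4] from twice the inner product, [1/4] from the second-order term
   ([q3]), [1/2] from splitting [2 C eps D] ([q5]); the sum is [- 1]. The last two sources each
   leave [2 a C^2 eps^2]. *)
have q1 := ler_wpM2l a0 eb.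
have q2 := ler_wpM2l (sqr_ge0 a) nb2.
have q3 : a ^+ 2 * (8 * gamma ^+ 2 * D ^+ 2) <= 4^-1 * (a * D ^+ 2).
  have := ler_wpM2r (mulr_ge0 a0 (sqr_ge0 D)) a32; lra.
have q4 : a ^+ 2 * (C * eps) ^+ 2 <= a * (C * eps) ^+ 2.
  apply: ler_wpM2r; first exact: sqr_ge0.
  have g2 : 1 <= gamma ^+ 2 by rewrite exprn_ege1.
  have ag : a <= gamma ^+ 2 * a by rewrite ler_peMl.
  by rewrite expr2 ler_piMl//; lra.
have q5 : a * (C * eps * D) <= a * (4^-1 * D ^+ 2 + (C * eps) ^+ 2).
  by apply: ler_wpM2l => //; have := sqr_ge0 (2^-1 * D - C * eps); nra.
rewrite -exprMn -/C; nra.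
Qed.

End deterministic_contraction.

(** This is the statement for one noise path. Closeness is assumed at projections of [x k], where
    the posterior means are taken, but the obtuse angle at every point, since the Lyapunov function
    is the squared distance from [y k] to [K]. *)
Lemma guided_trajectory_cvg (R : realType) (d : nat) (K : set 'rV[R]_d)
    (gamma M : R) (x y mu0 mu : nat -> 'rV[R]_d) (lam v a s : nat -> R) :
  convex_set K -> compact K -> K !=set0 -> (forall z, K z -> enorm z <= M) ->
  1 <= gamma ->
  (forall k, 0 < lam k <= 1) -> lam @ \oo --> (1 : R) ->
  (forall k, 0 <= v k) -> v @ \oo --> (0 : R) ->
  (forall k, 0 <= a k) -> (forall k, 32 * gamma ^+ 2 * a k <= 1) ->
  (forall k, 0 < s k) -> s @ \oo --> (0 : R) ->
  (forall k, 1 - a k <= s k.+1 / s k) ->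
  (forall k, enorm (mu0 k) <= M) ->
  (forall k z P, is_proj K z P -> dotv (z - P) (mu0 k - P) <= 0) ->
  enorm (x k - y k) @[k --> \oo] --> (0 : R) ->
  (forall eps, 0 < eps -> \forall k \near \oo, forall P, is_proj K (x k) P ->
    enorm (x k - lam k *: mu0 k) <= enorm (x k - P) + eps /\
    enorm (x k - lam k *: mu k) <= enorm (x k - P) + eps) ->
  (forall k, y k.+1 = y k + a k *: (gamma *: (lam k *: mu0 k - x k)
     + (gamma - 1) *: (x k - lam k *: mu k) + v k *: x k)) ->
  dist_set (x k) K @[k --> \oo] --> (0 : R).
Proof.
move=> cK coK K0 KM g1 lam01 lam1 v0 vcvg a0 a32 s0 scvg as_ mu0M obt xycvg
  close yE.
have M0 : 0 <= M by have [z /KM] := K0; apply: le_trans; exact: enorm_ge0.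
have [P Pproj] := choice (fun k => exists_proj (y k) coK K0).
have Dcvg : enorm (y k - P k) ^+ 2 @[k --> \oo] --> (0 : R).
  apply: (@contraction_cvg0 _ _ a s) => // [k|k|eta eta0].
  - exact: sqr_ge0.
  - have g2 : 1 <= gamma ^+ 2 by rewrite exprn_ege1.
    have : a k <= gamma ^+ 2 * a k by rewrite ler_peMl.
    by have := a32 k; have := a0 k; lra.
  - pose C := gamma * M + 4 * gamma + M + 1.
    have gM : 0 <= gamma * M by rewrite mulr_ge0//; lra.
    have C0 : 0 < C by rewrite /C; lra.
    (* The bound by [1] gives [eps ^+ 2 <= eps], so the third entry makes the error of [guided_step]
       at most [eta]. *)
    pose eps := Num.min 8^-1 (Num.min 1 (eta / (4 * C ^+ 2))).
    have eps0 : 0 < eps.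
      by rewrite !lt_min invr_gt0 ltr0n ltr01 divr_gt0// mulr_gt0// exprn_gt0.
    have eps8 : eps <= 8^-1 by rewrite ge_min lexx.
    have epseta : 4 * C ^+ 2 * eps ^+ 2 <= eta.
      have e1 : eps <= 1 by rewrite /eps !ge_min lexx orbT.
      have : eps <= eta / (4 * C ^+ 2) by rewrite /eps !ge_min lexx !orbT.
      rewrite ler_pdivlMr ?mulr_gt0 ?exprn_gt0// mulrC; apply: le_trans.
      apply: ler_wpM2l; first by rewrite mulr_ge0 ?sqr_ge0.
      by rewrite expr2 ler_piMl// ltW.
    have lamn : \forall k \near \oo, 1 - lam k <= eps.
      have /cvgrPdist_le/(_ _ eps0) := lam1; apply: filterS => k.
      by apply: le_trans; exact: ler_norm.
    have vn : \forall k \near \oo, v k <= eps.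
      have /cvgrPdist_le/(_ _ eps0) := vcvg; apply: filterS => k.
      by rewrite sub0r normrN; apply: le_trans; exact: ler_norm.
    have xyn : \forall k \near \oo, enorm (x k - y k) <= eps / 2.
      have e2 : 0 < eps / 2 by rewrite divr_gt0.
      have /cvgrPdist_le/(_ _ e2) := xycvg; apply: filterS => k.
      by rewrite sub0r normrN; apply: le_trans; exact: ler_norm.
    near=> k.
    have lamk : 1 - lam k <= eps by near: k.
    have vk : v k <= eps by near: k.
    have xyk : enorm (x k - y k) <= eps / 2 by near: k.
    have cl : forall Q, is_proj K (x k) Q ->
        enorm (x k - lam k *: mu0 k) <= enorm (x k - Q) + eps /\
        enorm (x k - lam k *: mu k) <= enorm (x k - Q) + eps.
      by near: k; exact: close.
    have [Q Qproj] := exists_proj (x k) coK K0.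
    have [c1 c2] := cl _ Qproj.
    (* Going from the projection of [x k] to that of [y k] costs [eps / 2]; the slack [2 * eps] in
       [guided_step] covers this and [eps]. *)
    have xQ : enorm (x k - Q) <= enorm (y k - P k) + eps / 2.
      apply: (le_trans (Qproj.2 _ (Pproj k).1)).
      have -> : x k - P k = (x k - y k) + (y k - P k).
        by rewrite addrA subrK.
      by apply: (le_trans (enormD _ _)); lra.
    have := @guided_step R d gamma M (lam k) (v k) (a k) eps (x k) (y k) (P k)
      (mu0 k) (mu k) g1 M0 (lam01 k) lamk _ eps8 (a0 k) (a32 k)
      (KM _ (Pproj k).1) (mu0M k) (obt _ _ _ (Pproj k)).
    rewrite -yE v0 vk => /(_ isT) step.
    (* The old projection [P k] is a competitor for [y k.+1], so the moving projection can only
       help. *)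
    apply: (@le_trans _ _ (enorm (y k.+1 - P k) ^+ 2)).
      rewrite ler_pXn2r ?nnegrE ?enorm_ge0//.
      exact: ((Pproj k.+1).2 _ (Pproj k).1).
    apply: le_trans (step _ _ _) _ => //; [lra|lra|lra|].
    by rewrite lerD2l ler_wpM2l.
apply/cvgrPdist_le => e e0.
have e2 : 0 < e / 2 by rewrite divr_gt0.
have xyn : \forall k \near \oo, enorm (x k - y k) <= e / 2.
  have /cvgrPdist_le/(_ _ e2) := xycvg; apply: filterS => k.
  by rewrite sub0r normrN; apply: le_trans; exact: ler_norm.
have Dn : \forall k \near \oo, enorm (y k - P k) ^+ 2 <= (e / 2) ^+ 2.
  have /cvgrPdist_le/(_ _ (exprn_gt0 2 e2)) := Dcvg; apply: filterS => k.
  by rewrite sub0r normrN; apply: le_trans; exact: ler_norm.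
near=> k.
rewrite sub0r normrN ger0_norm ?dist_set_ge0//.
apply: (le_trans (dist_set_le _ (Pproj k).1)).
have -> : x k - P k = (x k - y k) + (y k - P k) by rewrite addrA subrK.
apply: (le_trans (enormD _ _)).
have h1 : enorm (x k - y k) <= e / 2 by near: k.
have : enorm (y k - P k) <= e / 2.
  rewrite -(@ler_pXn2r _ 2) ?nnegrE ?enorm_ge0 ?(ltW e2)//.
  by near: k.
lra.
Unshelve. all: by end_near. Qed.

(** * Posterior means of smoothed densities *)

Section smoothed_density.
Context (R : realType) (d : nat) (q : 'rV[R]_d -> R) (M : R).
Implicit Types (f g : 'rV[R]_d -> R) (x u v : 'rV[R]_d).
Hypothesis q_pdf : is_pdf q.
Hypothesis q_supp : forall u, q u != 0 -> enorm u <= M.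

Local Notation mu := (@lebesgue_rV R d).

Definition qmean f : R := \int[mu]_u (q u * f u).

(** Boundedness is asked only on the ball that carries [q]. The class then contains the coordinates
    and the Gaussian kernel and is closed under sums and products, which settles the integrability
    of each integrand below. *)
Definition admissible f :=
  measurable_fun setT f /\ exists B, forall u, enorm u <= M -> `|f u| <= B.

Lemma pdf_ge0 u : 0 <= q u. Proof. by case: q_pdf. Qed.

Lemma measurable_pdf : measurable_fun setT q. Proof. by case: q_pdf. Qed.

Lemma integrable_pdf : mu.-integrable setT (EFin \o q).
Proof.
case: q_pdf => mq q0 q1; apply/integrableP; split; first exact/measurable_EFinP.
rewrite (eq_integral (fun u => (q u)%:E)) ?q1 ?ltry// => u _ /=.
by rewrite ger0_norm.
Qed.

Lemma integrable_qmean f : admissible f ->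
  mu.-integrable setT (EFin \o (fun u => q u * f u)).
Proof.
move=> [mf [B fB]].
apply: (@le_integrable _ _ _ mu setT measurableT _
    (fun u => (`|B|)%:E * (EFin \o q) u)%E).
- by apply/measurable_EFinP; apply: measurable_funM => //; exact: measurable_pdf.
- move=> u _ /=; rewrite lee_fin normrM (ger0_norm (pdf_ge0 _)).
  rewrite normrM normr_id (ger0_norm (pdf_ge0 _)) mulrC.
  have [->|/q_supp uM] := eqVneq (q u) 0; first by rewrite !mulr0.
  by rewrite ler_wpM2r ?pdf_ge0// (le_trans (fB _ uM))// ler_norm.
- exact: integrableZl integrable_pdf.
Qed.

Lemma admissible_cst c : admissible (cst c).
Proof. by split; [exact: measurable_cst|exists `|c|]. Qed.

Lemma admissibleD f g : admissible f -> admissible g ->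
  admissible (fun u => f u + g u).
Proof.
move=> [mf [B fB]] [mg [C gC]]; split; first exact: measurable_funD.
exists (B + C) => u uM; rewrite (le_trans (ler_normD _ _))// lerD//.
  exact: fB.
exact: gC.
Qed.

Lemma admissibleM f g : admissible f -> admissible g ->
  admissible (fun u => f u * g u).
Proof.
move=> [mf [B fB]] [mg [C gC]]; split; first exact: measurable_funM.
exists (B * C) => u uM; rewrite normrM ler_pM//.
  exact: fB.
exact: gC.
Qed.

Lemma admissibleZ c f : admissible f -> admissible (fun u => c * f u).
Proof. by move=> af; apply: admissibleM => //; exact: admissible_cst. Qed.

Lemma admissible_sum n (f : 'I_n -> 'rV[R]_d -> R) :
  (forall i, admissible (f i)) -> admissible (fun u => \sum_i f i u).
Proof.
move=> af; have -> : (fun u => \sum_i f i u) = \sum_i f i.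
  by apply/funext => u; rewrite fct_sumE.
elim/big_ind: _ => [|g h ag ah|i _]; [exact: admissible_cst|exact: admissibleD|].
exact: af.
Qed.

Lemma admissible_coord i : admissible (fun u => u ord0 i).
Proof.
split; first exact: (measurable_rV_coord i).
by exists M => u uM; apply: le_trans uM; exact: coord_le_enorm.
Qed.

Lemma admissible_dotv x : admissible (dotv x).
Proof.
apply: admissible_sum => i; apply: admissibleZ; exact: admissible_coord.
Qed.

Lemma qmeanD f g : admissible f -> admissible g ->
  qmean (fun u => f u + g u) = qmean f + qmean g.
Proof.
move=> af ag; rewrite /qmean -RintegralD//; try exact: integrable_qmean.
by apply: eq_Rintegral => u _; rewrite mulrDr.
Qed.

Lemma qmeanZ c f : admissible f -> qmean (fun u => c * f u) = c * qmean f.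
Proof.
move=> af; rewrite /qmean -RintegralZl//; last exact: integrable_qmean.
by apply: eq_Rintegral => u _; rewrite mulrCA.
Qed.

Lemma qmean_sum n (f : 'I_n -> 'rV[R]_d -> R) : (forall i, admissible (f i)) ->
  qmean (fun u => \sum_i f i u) = \sum_i qmean (f i).
Proof.
elim: n f => [|n IH] f af.
  rewrite big_ord0 -[RHS](mul0r (qmean (cst 1))) -qmeanZ; last exact: admissible_cst.
  by congr qmean; apply/funext => u; rewrite big_ord0 mul0r.
rewrite big_ord_recl -IH// -qmeanD//; last exact: admissible_sum.
by congr qmean; apply/funext => u; rewrite big_ord_recl.
Qed.

Lemma le_qmean f g : admissible f -> admissible g ->
  (forall u, q u != 0 -> f u <= g u) -> qmean f <= qmean g.
Proof.
move=> af ag fg; apply: le_Rintegral => //; try exact: integrable_qmean.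
move=> u _; have [->|qu] := eqVneq (q u) 0; first by rewrite !mul0r.
by rewrite ler_wpM2l ?pdf_ge0// fg.
Qed.

Lemma qmean_cst c : qmean (cst c) = c.
Proof.
have -> : cst c = (fun u : 'rV[R]_d => c * cst 1 u).
  by apply/funext => u; rewrite mulr1.
rewrite qmeanZ; last exact: admissible_cst.
rewrite /qmean /Rintegral; under eq_integral do rewrite mulr1.
by case: q_pdf => _ _ ->; rewrite mulr1.
Qed.

Section kernel.
Context (lam tau : R).
Hypothesis tau_gt0 : 0 < tau.

(** With [tau = 2 sigma^2] this is the Gaussian density without its normalizing constant, which
    cancels in posterior means and in gradients of logarithms. *)
Definition gker v : R := expR (- (enorm v ^+ 2 / tau)).

Lemma gker_gt0 v : 0 < gker v. Proof. exact: expR_gt0. Qed.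

Lemma enorm_sqr_affine x u : enorm (x - lam *: u) ^+ 2 =
  \sum_(i < d) (x ord0 i + (- lam) * u ord0 i) * (x ord0 i + (- lam) * u ord0 i).
Proof. by rewrite enorm_sqr; apply: eq_bigr => i _; rewrite !mxE mulNr. Qed.

Lemma admissible_sqdist x : admissible (fun u => enorm (x - lam *: u) ^+ 2).
Proof.
under eq_fun do rewrite enorm_sqr_affine.
apply: admissible_sum => i.
have a : admissible (fun u => x ord0 i + (- lam) * u ord0 i).
  apply: admissibleD; first exact: admissible_cst.
  by apply: admissibleZ; exact: admissible_coord.
exact: admissibleM.
Qed.

Lemma admissible_gker x : admissible (fun u => gker (x - lam *: u)).
Proof.
split; last first.
  exists 1 => u _; rewrite ger0_norm ?expR_ge0//.
  by rewrite -[leRHS]expR0 ler_expR oppr_le0 divr_ge0 ?sqr_ge0// ltW.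
rewrite /gker; apply: measurableT_comp => //; apply: measurableT_comp => //.
by apply: measurable_funM => //; case: (admissible_sqdist x).
Qed.

Definition gsmooth x : R := qmean (fun u => gker (x - lam *: u)).

(** On the ball carrying [q] the kernel is at least a positive constant, whose mean is itself
    because [q] has mass one. *)
Lemma gsmooth_gt0 x : 0 < gsmooth x.
Proof.
pose c := expR (- ((enorm x + `|lam| * M) ^+ 2 / tau)).
have c0 : 0 < c := expR_gt0 _.
apply: (lt_le_trans c0); rewrite -[leLHS]qmean_cst; apply: le_qmean.
- exact: admissible_cst.
- exact: admissible_gker.
- move=> u /q_supp uM /=; rewrite ler_expR lerN2 ler_wpM2r ?invr_ge0 ?(ltW tau_gt0)//.
  have h : enorm (x - lam *: u) <= enorm x + `|lam| * M.
    by rewrite (le_trans (enormB_le _ _))// lerD2l enormZ ler_wpM2l.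
  by rewrite ler_pXn2r ?nnegrE ?enorm_ge0//; apply: le_trans h; exact: enorm_ge0.
Qed.

(** Bayes' formula: [q] is the prior of [u], and [x] is observed as [lam *: u] plus Gaussian
    noise. *)
Definition post f x : R :=
  qmean (fun u => f u * gker (x - lam *: u)) / gsmooth x.

Definition pmean x : 'rV[R]_d := \row_i post (fun u => u ord0 i) x.

Let admK f x : admissible f -> admissible (fun u => f u * gker (x - lam *: u)).
Proof. by move=> af; apply: admissibleM => //; exact: admissible_gker. Qed.

Lemma postD f g x : admissible f -> admissible g ->
  post (fun u => f u + g u) x = post f x + post g x.
Proof.
move=> af ag; rewrite /post -mulrDl -qmeanD; try exact: admK.
by congr (_ / _); congr qmean; apply/funext => u; rewrite mulrDl.
Qed.

Lemma postZ c f x : admissible f -> post (fun u => c * f u) x = c * post f x.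
Proof.
move=> af; rewrite /post mulrA -qmeanZ; last exact: admK.
by congr (_ / _); congr qmean; apply/funext => u; rewrite mulrA.
Qed.

Lemma post_cst c x : post (cst c) x = c.
Proof.
by rewrite /post qmeanZ ?mulfK ?gt_eqF ?gsmooth_gt0//; exact: admissible_gker.
Qed.

Lemma le_post f g x : admissible f -> admissible g ->
  (forall u, q u != 0 -> f u <= g u) -> post f x <= post g x.
Proof.
move=> af ag fg; rewrite ler_wpM2r ?invr_ge0 ?(ltW (gsmooth_gt0 _))//.
apply: le_qmean; try exact: admK.
by move=> u qu; rewrite ler_wpM2r ?(ltW (gker_gt0 _))// fg.
Qed.

Lemma dotv_pmean x v : dotv v (pmean x) = post (dotv v) x.
Proof.
rewrite /post /dotv.
under [in RHS]eq_fun do rewrite mulr_suml.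
rewrite qmean_sum; last first.
  by move=> i; apply: admK; apply: admissibleZ; exact: admissible_coord.
rewrite mulr_suml; apply: eq_bigr => i _; rewrite mxE -postZ//.
exact: admissible_coord.
Qed.

(** Convexity is transferred to posterior means through half-spaces only: with [v] the mean itself
    this bounds its norm, and with [v] normal to the projection it gives the obtuse angle. *)
Lemma pmean_halfspace x v c : (forall u, q u != 0 -> dotv v u <= c) ->
  dotv v (pmean x) <= c.
Proof.
move=> h; rewrite dotv_pmean -(post_cst c x); apply: le_post => //.
  exact: admissible_dotv.
exact: admissible_cst.
Qed.

Lemma pmean_enorm x : enorm (pmean x) <= M.
Proof.
(* If [M] were negative, [q] would vanish everywhere and could not have mass one. *)
have M0 : 0 <= M.
  rewrite leNgt; apply/negP => Mlt0.
  have : (0 : R) = 1.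
    rewrite -(qmean_cst 1) /qmean /Rintegral -[LHS](congr1 (@fine R) (integral0 mu setT)).
    congr fine; apply: eq_integral => u _ /=.
    have [->|/q_supp] := eqVneq (q u) 0; first by rewrite mul0r.
    by rewrite leNgt (lt_le_trans Mlt0)// enorm_ge0.
  by move/eqP; rewrite eq_sym oner_eq0.
have [->|n0] := eqVneq (enorm (pmean x)) 0; first by [].
have n1 : 0 < enorm (pmean x) by rewrite lt_neqAle eq_sym n0 enorm_ge0.
rewrite -(ler_pM2l n1) -expr2 enorm_sqr; apply: pmean_halfspace => u qu.
apply: (le_trans (cauchy_schwarz_dotv _ _)).
by rewrite ler_wpM2l ?enorm_ge0// q_supp.
Qed.

(* Jensen twice: first for the square, then, through [v e^-v <= 1 - e^-v],
   for the relative entropy of the posterior. *)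
Lemma pmean_close x :
  enorm (x - lam *: pmean x) ^+ 2 <= tau * - ln (gsmooth x).
Proof.
have A0 := gsmooth_gt0 x.
set L := - ln (gsmooth x).
have AE : gsmooth x = expR (- L) by rewrite opprK lnK.
pose h u := enorm (x - lam *: u) ^+ 2 / tau.
have ah : admissible h.
  rewrite /h; under eq_fun do rewrite mulrC.
  exact/admissibleZ/admissible_sqdist.
have posth : post h x <= L.
  rewrite /post ler_pdivrMr//.
  have -> : L * gsmooth x = qmean (fun u => L * gker (x - lam *: u)).
    by rewrite qmeanZ//; exact: admissible_gker.
  rewrite -subr_ge0 -mulN1r -qmeanZ; last exact: admK.
  rewrite -qmeanD; last 2 first.
  - exact/admissibleZ/admissible_gker.
  - exact/admissibleZ/admK.
  (* Zero is the mean of [gker - expR (- L)], by the definition of [L]. Pointwise [expR (- L) = gker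
     * expR (h - L) >= gker * (1 + h - L)], so this integrand lies below [(L - h) * gker]. *)
  rewrite -[leLHS](_ : qmean (fun u => gker (x - lam *: u) + - expR (- L)) = 0).
  apply: le_qmean => [||u _].
  - apply: admissibleD; [exact: admissible_gker|exact: admissible_cst].
  - by apply: admissibleD; apply: admissibleZ; [exact: admissible_gker|exact: admK].
  - have -> : expR (- L) = gker (x - lam *: u) * expR (h u - L).
      by rewrite -expRD; congr expR; rewrite /h; ring.
    have := ler_wpM2l (ltW (gker_gt0 (x - lam *: u))) (expR_ge1Dx (h u - L)).
    rewrite /=; lra.
  - rewrite qmeanD; [|exact: admissible_gker|exact: admissible_cst].
    by rewrite qmean_cst -/(gsmooth x) AE subrr.
have affE v : (fun u => dotv v (x - lam *: u)) =
            (fun u => cst (dotv v x) u + (- lam) * dotv v u).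
  by apply/funext => u; rewrite !dotvE mulNr.
(* Jensen for the square by its tangent: with [v] the mean of [z = x - lam *: u], [|v|^2] is the
   mean of [2 <v, z> - |v|^2], which is at most [|z|^2] for each [u]. *)
have -> : enorm (x - lam *: pmean x) ^+ 2 =
    2 * dotv (x - lam *: pmean x) (x - lam *: pmean x)
    - enorm (x - lam *: pmean x) ^+ 2 by rewrite enorm_sqr; ring.
set v := x - lam *: pmean x.
have -> : dotv v v = post (fun u => dotv v (x - lam *: u)) x.
  rewrite affE.
  rewrite postD; [|exact: admissible_cst|exact/admissibleZ/admissible_dotv].
  rewrite post_cst postZ; last exact: admissible_dotv.
  by rewrite -dotv_pmean {2}/v dotvDr dotvNr dotvZr mulNr.
have adv : admissible (fun u => dotv v (x - lam *: u)).
  rewrite affE.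
  by apply: admissibleD; [exact: admissible_cst|exact/admissibleZ/admissible_dotv].
rewrite lerBlDr -postZ//; apply: (@le_trans _ _
    (post (fun u => tau * h u + cst (enorm v ^+ 2) u) x)).
  apply: le_post => [||u _]; first exact: admissibleZ.
    by apply: admissibleD; [exact: admissibleZ|exact: admissible_cst].
  have -> : tau * h u = enorm (x - lam *: u) ^+ 2.
    by rewrite /h mulrC divfK ?gt_eqF.
  rewrite /=.
  have := cauchy_schwarz_dotv v (x - lam *: u).
  have := sqr_ge0 (enorm (x - lam *: u) - enorm v); nra.
rewrite postD; [|exact: admissibleZ|exact: admissible_cst].
by rewrite post_cst postZ// lerD2r ler_wpM2l ?(ltW tau_gt0).
Qed.

End kernel.
End smoothed_density.

(** * Tweedie's formula: differentiation of smoothed densities *)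

Section gradient_smoothed.
Context (R : realType) (d : nat).
Implicit Types (x u z : 'rV[R]_d).

Lemma dotv_delta i z : dotv (delta_mx ord0 i) z = z ord0 i.
Proof.
rewrite /dotv (bigD1 i)//= big1 ?addr0 => [|j ji].
  by rewrite mxE !eqxx mul1r.
by rewrite mxE eqxx (negbTE ji) mul0r.
Qed.

Lemma is_derive_gker (tau : R) z i (h : R) :
  is_derive h 1 (fun k => gker tau (k *: delta_mx ord0 i + z))
    (- (2 / tau * (z ord0 i + h)) * gker tau (h *: delta_mx ord0 i + z)).
Proof.
have sqE k : enorm (k *: delta_mx ord0 i + z) ^+ 2 =
    k ^+ 2 + 2 * z ord0 i * k + enorm z ^+ 2.
  rewrite !enorm_sqr !dotvE (dotvC z (delta_mx _ _)) !dotv_delta mxE !eqxx.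
  by rewrite mulr1n; ring.
rewrite /gker sqE.
under eq_fun do rewrite sqE.
apply: is_derive_eq.
rewrite !scaler1 /GRing.scale/=; move: (tau^-1) => w; ring.
Qed.

(** Only a derivative along [v] is given, so the chain rule is applied to [h |-> g (h *: v + x)],
    which has the same difference quotient at 0. *)
Lemma is_derive_ln_dir (g : 'rV[R]_d -> R) x (v : 'rV[R]_d) c : 0 < g x ->
  is_derive x v g (c * g x) -> is_derive x v (fun y => ln (g y)) c.
Proof.
move=> gx0 [dg cE].
pose F h := g (h *: v + x).
have F0 : F 0 = g x by rewrite /F scale0r add0r.
have quot (k : 'rV[R]_d -> R) : (fun h : R => h^-1 *: ((k \o shift x) (h *: v) - k x))
  = (fun h => h^-1 *: (((fun h => k (h *: v + x)) \o shift 0) (h *: (1 : R)) - k (0 *: v + x))).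
  by apply/funext => h /=; rewrite addr0 scale0r add0r /GRing.scale/= mulr1.
have dF : is_derive (0 : R) 1 F (c * g x).
  split; first by move: dg; rewrite /derivable quot.
  by rewrite -cE /derive quot.
have dlnF : is_derive (0 : R) 1 (fun h => ln (F h)) (c * g x * (g x)^-1).
  have dln : is_derive (F 0) 1 (@ln R) (g x)^-1.
    by rewrite F0; exact: is_derive1_ln.
  have := @is_derive1_comp _ (@ln R) F 0 _ _ dln dF.
  by rewrite mulrC.
have cc : c * g x * (g x)^-1 = c by rewrite mulfK ?gt_eqF.
rewrite cc in dlnF; case: dlnF => dl le.
split; first by rewrite /derivable (quot (fun y => ln (g y))).
by rewrite -le /derive (quot (fun y => ln (g y))).
Qed.

Context (q : 'rV[R]_d -> R) (M lam tau : R).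
Hypothesis q_pdf : is_pdf q.
Hypothesis q_supp : forall u, q u != 0 -> enorm u <= M.
Hypothesis tau_gt0 : 0 < tau.

(** Differentiation under the integral: the kernel's derivative brings down [x - lam *: u], and its
    weighted mean over [u] is [x - lam *: pmean] times [gsmooth]. *)
Lemma is_derive_gsmooth x i :
  is_derive x (delta_mx ord0 i) (gsmooth q lam tau)
    (- (2 / tau * (x - lam *: pmean q lam tau x) ord0 i) * gsmooth q lam tau x).
Proof.
set v : 'rV[R]_d := delta_mx ord0 i.
pose f h u := q u * gker tau (h *: v + (x - lam *: u)).
have df (h : R) u : is_derive h 1 (f^~ u)
    (q u * (- (2 / tau * ((x - lam *: u) ord0 i + h))
            * gker tau (h *: v + (x - lam *: u)))).
  have := is_derive_gker tau (x - lam *: u) i h.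
  by move=> /(is_deriveZ (q u)).
have d1f (h : R) u : derive1 (f^~ u) h = q u * (- (2 / tau * ((x - lam *: u) ord0 i + h))
            * gker tau (h *: v + (x - lam *: u))).
  by rewrite derive1E; case: (df h u).
(* Domination is needed for [h] in []-1, 1[] only: the last [1] bounds [|h|], and the kernel is at
   most 1, so [|C| * q] is an integrable majorant. *)
pose C := 2 / tau * (enorm x + `|lam| * M + 1).
have hx (h : R) u : h *: v + (x - lam *: u) = (h *: v + x) - lam *: u by rewrite addrA.
have cvg := @cvg_differentiation_under_integral R _ _ (@lebesgue_rV R d) f setT
  measurableT 0 (-1) 1 _ _ _ (fun u => `|C| * q u) _ _ _.
have Nf (h : R) : gsmooth q lam tau (h *: v + x) = \int[lebesgue_rV d]_u f h u.
  by apply: eq_Rintegral => u _; rewrite /f hx.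
have lim : h^-1 *: ((gsmooth q lam tau \o shift x) (h *: v) - gsmooth q lam tau x)
    @[h --> 0^'] --> 
    (- (2 / tau * (x - lam *: pmean q lam tau x) ord0 i) * gsmooth q lam tau x).
  have -> : (fun h => h^-1 *: ((gsmooth q lam tau \o shift x) (h *: v) - gsmooth q lam tau x))
     = (fun h => h^-1 *: ((\int[lebesgue_rV d]_u f (h + 0) u) - \int[lebesgue_rV d]_u f 0 u)).
    apply/funext => h; rewrite addr0 -!Nf scale0r add0r; congr (_ *: (_ - _)).
  have -> : - (2 / tau * (x - lam *: pmean q lam tau x) ord0 i) * gsmooth q lam tau x
     = \int[lebesgue_rV d]_u partial1of2 f 0 u.
    transitivity (qmean q (fun u => - (2 / tau) * (x ord0 i * gker tau (x - lam *: u)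
        + (- lam) * (u ord0 i * gker tau (x - lam *: u))))).
      have aK : admissible M (fun u => gker tau (x - lam *: u)).
        exact: admissible_gker.
      have aKu : admissible M (fun u => u ord0 i * gker tau (x - lam *: u)).
        by apply: admissibleM => //; exact: admissible_coord.
      rewrite (qmeanZ q_pdf q_supp); last first.
        by apply: admissibleD; exact: admissibleZ.
      rewrite (qmeanD q_pdf q_supp); try exact: admissibleZ.
      rewrite !(qmeanZ q_pdf q_supp)// !mxE /post.
      have := gsmooth_gt0 q_pdf q_supp lam tau_gt0 x; rewrite -/(gsmooth q lam tau x).
      by move=> g0; field; rewrite !gt_eqF.
    apply: eq_Rintegral => u _; rewrite /partial1of2 d1f scale0r add0r !mxE.
    by congr (_ * _); ring.
  apply: cvg.
  - by rewrite /= in_itv/= ltrN10 ltr01.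
  - move=> h _; have := @integrable_qmean R d q M q_pdf q_supp
      (fun u => gker tau (h *: v + x - lam *: u)) (@admissible_gker R d M lam tau tau_gt0 _).
    by congr (_.-integrable _ _); apply/funext => u /=; rewrite /f hx.
  - by move=> h u _ _; exact: (@ex_derive _ _ _ _ _ _ _ (df h u)).
  - by move=> u; rewrite mulr_ge0 ?(pdf_ge0 q_pdf).
  - exact: (integrableZl measurableT `|C| (integrable_pdf q_pdf)).
  - move=> h u; rewrite /= in_itv/= => /andP[h1 h2] _; rewrite /partial1of2 d1f.
    rewrite mulrC normrM (ger0_norm (pdf_ge0 q_pdf u)).
    have [->|/q_supp uM] := eqVneq (q u) 0; first by rewrite !mulr0.
    rewrite ler_wpM2r ?(pdf_ge0 q_pdf)// normrM -[leRHS]mulr1 ler_pM//; last first.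
      rewrite ger0_norm ?expR_ge0// -[leRHS]expR0 ler_expR oppr_le0.
      by rewrite divr_ge0 ?sqr_ge0 ?(ltW tau_gt0).
    rewrite (le_trans _ (ler_norm _))// normrN normrM ger0_norm ?divr_ge0 ?(ltW tau_gt0)//.
    rewrite /C ler_wpM2l ?divr_ge0 ?(ltW tau_gt0)// (le_trans (ler_normD _ _))// lerD//.
      rewrite (le_trans (coord_le_enorm _ _))// (le_trans (enormB_le _ _))// lerD2l.
      by rewrite enormZ ler_wpM2l.
    by rewrite ler_norml; apply/andP; split; lra.
apply: DeriveDef; first by apply/cvg_ex; eexists; exact: lim.
exact: cvg_lim lim.
Qed.

Lemma is_derive_ln_gsmooth x i :
  is_derive x (delta_mx ord0 i) (fun y => ln (gsmooth q lam tau y))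
    (- (2 / tau * (x - lam *: pmean q lam tau x) ord0 i)).
Proof.
exact: is_derive_ln_dir (gsmooth_gt0 q_pdf q_supp lam tau_gt0 x)
  (is_derive_gsmooth x i).
Qed.

End gradient_smoothed.

(** * Laplace lower bound *)

Section laplace_lower_bound.
Context (R : realType) (d : nat).
Implicit Types (x u c P : 'rV[R]_d) (K : set 'rV[R]_d).

(** Boxes are the balls of the sup norm, so interior points provide them, and their volume is an
    explicit product. *)
Definition box c (r : R) : set 'rV[R]_d :=
  [set u | forall i, `]c ord0 i - r, c ord0 i + r[%classic (u ord0 i)].

Lemma measurable_box c r : measurable (box c r).
Proof.
rewrite (_ : box c r = \bigcap_(i in [set: 'I_d])
    (@rV_coord R d i @^-1` `]c ord0 i - r, c ord0 i + r[%classic)).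
  apply: fin_bigcap_measurable => // i _.
  rewrite -[X in measurable X]setTI.
  exact: (measurable_rV_coord i measurableT (measurable_itv _)).
by apply/seteqP; split => u /= h i; [move=> _|]; exact: h.
Qed.

Lemma lebesgue_box c r : 0 < r -> lebesgue_rV d (box c r) = ((2 * r) ^+ d)%:E.
Proof.
move=> r0; pose A i : set (measurableTypeR R) := `]c ord0 i - r, c ord0 i + r[%classic.
rewrite (_ : box c r = [set u | forall i, A i (u ord0 i)])//.
rewrite lebesgue_rV_box; last by move=> i; exact: measurable_itv.
rewrite (eq_bigr (fun=> (2 * r)%:E)) => [|i _].
  by rewrite -[in RHS](card_ord d) -prodr_const -prodEFin.
rewrite /A lebesgue_measure_itv/= lte_fin ltrBlDr -addrA ltrDl addr_gt0//.
by rewrite -EFinD; congr EFin; ring.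
Qed.

Lemma interior_box K : K° !=set0 -> exists c r, 0 < r /\ box c r `<=` K.
Proof.
move=> [c /nbhs_ballP[r /= r0 cK]]; exists c, r; split=> // u cu; apply: cK.
split=> // i j; have := cu j; rewrite /= in_itv/= => /andP[u1 u2].
by rewrite (ord1 i) /ball/= ltr_distlC u1 u2.
Qed.

(** The homothety of centre [P] and ratio [th] sends the box into [K] by convexity. Its image has a
    volume independent of [P] and lies within [th] times the diameter of [K] from [P]. *)
Lemma convex_shrink_box K c r P th : convex_set K -> box c r `<=` K -> K P ->
  0 < th -> th <= 1 -> box ((1 - th) *: P + th *: c) (th * r) `<=`
  [set u | K u /\ exists2 z, K z & u - P = th *: (z - P)].
Proof.
move=> cK bK KP th0 th1 u bu.
have [z uE] : exists z, u = th *: z + (1 - th) *: P.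
  exists (th^-1 *: (u - (1 - th) *: P)).
  by rewrite scalerA divff ?gt_eqF// scale1r subrK.
have Kz : K z.
  apply: bK => i; have := bu i; rewrite /= !in_itv/= uE !mxE => /andP[h1 h2].
  by apply/andP; split; rewrite -(ltr_pM2l th0); lra.
split; first by rewrite uE; apply: convex_setP => //; exact: ltW.
exists z => //; rewrite {1}uE; apply/rowP => i; rewrite !mxE; ring.
Qed.

Context (q : 'rV[R]_d -> R) (M : R) (K : set 'rV[R]_d) (rho : R).
Hypothesis q_pdf : is_pdf q.
Hypothesis q_supp : forall u, q u != 0 -> enorm u <= M.
Hypothesis K_convex : convex_set K.
Hypothesis K_int : K° !=set0.
Hypothesis K_M : forall z, K z -> enorm z <= M.
Hypothesis rho_gt0 : 0 < rho.
Hypothesis q_rho : forall z, K z -> rho <= q z.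

(** The integral is restricted to the shrunken box. There [u - P = th *: (z - P)] has norm at most
    [2 M th], and replacing [u] by [lam *: u] costs [(1 - lam) * M]. *)
Lemma gsmooth_ge (c : 'rV[R]_d) r P x th lam tau : 0 < r -> box c r `<=` K -> K P ->
  0 < th -> th <= 1 -> 0 < lam <= 1 -> 0 < tau ->
  rho * (2 * (th * r)) ^+ d *
    expR (- ((enorm (x - P) + 2 * M * th + (1 - lam) * M) ^+ 2 / tau))
  <= gsmooth q lam tau x.
Proof.
move=> r0 bK KP th0 th1 /andP[l0 l1] tau0.
set E := expR _.
have M0 : 0 <= M by apply: le_trans (K_M KP); exact: enorm_ge0.
pose B := box ((1 - th) *: P + th *: c) (th * r).
have thr : 0 < th * r by rewrite mulr_gt0.
have BK := convex_shrink_box K_convex bK KP th0 th1.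
have ig : (lebesgue_rV d).-integrable setT
    (EFin \o (fun u => q u * gker tau (x - lam *: u))).
  exact: (integrable_qmean q_pdf q_supp (@admissible_gker R d M lam tau tau0 x)).
rewrite -lee_fin /gsmooth /qmean /Rintegral fineK; last exact: integrable_fin_num.
apply: (@le_trans _ _ (\int[lebesgue_rV d]_(u in B) (rho * E)%:E)%E).
  rewrite integral_cst; last exact: measurable_box.
  by rewrite /B [X in (_ * X)%E]lebesgue_box// -EFinM lee_fin mulrAC.
have mf : measurable_fun setT (fun u => (q u * gker tau (x - lam *: u))%:E).
  exact: measurable_int ig.
apply: (@le_trans _ _ (\int[lebesgue_rV d]_(u in B) (q u * gker tau (x - lam *: u))%:E)%E).
  apply: ge0_le_integral => //=; first exact: measurable_box.
  - by move=> u _; rewrite lee_fin mulr_ge0 ?expR_ge0 ?(ltW rho_gt0).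
  - exact: measurable_funTS.
  - move=> u /BK[Ku [z Kz uP]]; rewrite lee_fin ler_pM ?expR_ge0 ?(ltW rho_gt0) ?q_rho//.
    rewrite ler_expR lerN2 ler_wpM2r ?invr_ge0 ?(ltW tau0)//.
    have : enorm (x - lam *: u) <= enorm (x - P) + 2 * M * th + (1 - lam) * M.
      have -> : x - lam *: u = (x - P) - (th *: (z - P)) + (1 - lam) *: u.
        by rewrite -uP; apply/rowP => i; rewrite !mxE; ring.
      rewrite (le_trans (enormD _ _))// enormZ lerD//.
        rewrite (le_trans (enormB_le _ _))// lerD2l enormZ gtr0_norm// mulrC.
        rewrite ler_wpM2r ?(ltW th0)// (le_trans (enormB_le _ _))//.
        by have := K_M Kz; have := K_M KP; lra.
      by rewrite ger0_norm ?subr_ge0// ler_wpM2l ?subr_ge0// K_M.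
    move=> h; rewrite ler_pXn2r ?nnegrE ?enorm_ge0//.
    by apply: le_trans h; exact: enorm_ge0.
apply: ge0_subset_integral => //; first exact: measurable_box.
by move=> u _; rewrite lee_fin mulr_ge0 ?expR_ge0 ?(pdf_ge0 q_pdf).
Qed.

(** The mass [L] of the shrunken box is fixed before [x] and [P], and [ln L] enters [pmean_close]
    multiplied by [tau]. The point [x] acts only through [|x - P|], whence the uniformity. *)
Lemma pmean_close_unif eps : 0 < eps -> exists2 delta, 0 < delta &
  forall lam tau, 0 < lam <= 1 -> 1 - lam <= delta -> 0 < tau -> tau <= delta ->
  forall x P, K P -> enorm (x - lam *: pmean q lam tau x) <= enorm (x - P) + eps.
Proof.
move=> e0.
have [c [r [r0 bK]]] := interior_box K_int.
have M0 : 0 <= M.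
  have [z /interior_subset Kz] := K_int.
  by apply: le_trans (K_M Kz); exact: enorm_ge0.
(* This makes [2 M th <= eps / 4]; the first bound in [delta] gives [(1 - lam) M <= eps / 4], and
   the second [tau * |ln L| <= (eps / 2)^2]. *)
pose th := Num.min 1 (eps / (8 * (M + 1))).
have M8 : 0 < 8 * (M + 1) by rewrite mulr_gt0// ltr_wpDl.
have th0 : 0 < th by rewrite lt_min ltr01 divr_gt0.
have th1 : th <= 1 by rewrite ge_min lexx.
have thM : th * (8 * (M + 1)) <= eps by rewrite -ler_pdivlMr// ge_min lexx orbT.
pose L := rho * (2 * (th * r)) ^+ d.
have L0 : 0 < L by rewrite mulr_gt0// exprn_gt0// !mulr_gt0.
pose nL := 1 + `|ln L|.
have nL0 : 0 < nL by rewrite ltr_wpDr.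
exists (Num.min (eps / (4 * (M + 1))) (eps ^+ 2 / 4 / nL)).
  by rewrite lt_min !divr_gt0 ?exprn_gt0// mulr_gt0// ltr_wpDl.
move=> lam tau l01; rewrite !le_min => /andP[l1 _] tau0 /andP[_ tau1] x P KP.
have /andP[l0 l1'] := l01.
have g := gsmooth_ge x r0 bK KP th0 th1 l01 tau0.
rewrite -/L in g; set D := enorm (x - P) in g *.
have D0 : 0 <= D := enorm_ge0 _.
set S := D + _ + _ in g.
have lng : - ln (gsmooth q lam tau x) <= - ln L + S ^+ 2 / tau.
  have <- : - ln (L * expR (- (S ^+ 2 / tau))) = - ln L + S ^+ 2 / tau.
    by rewrite lnM ?posrE ?expR_gt0// expRK; ring.
  rewrite lerN2 ler_ln ?posrE//; last exact: (gsmooth_gt0 q_pdf q_supp).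
  by rewrite mulr_gt0 ?expR_gt0.
have hS : S <= D + eps / 2.
  rewrite ler_pdivlMr in l1; last by rewrite mulr_gt0// ltr_wpDl.
  rewrite /S; lra.
have S0 : 0 <= S by rewrite /S !addr_ge0// !mulr_ge0// ?subr_ge0// ltW.
have ht : tau * - ln L <= (eps / 2) ^+ 2.
  have h1 : tau * - ln L <= tau * nL.
    rewrite ler_wpM2l ?(ltW tau0)// /nL.
    by have := ler_norm (- ln L); rewrite normrN; lra.
  apply: (le_trans h1); move: tau1; rewrite ler_pdivlMr// => /le_trans; apply.
  by rewrite le_eqVlt; apply/orP; left; apply/eqP; field.
rewrite -(@ler_pXn2r _ 2) ?nnegrE ?enorm_ge0 ?addr_ge0 ?(ltW e0)//.
apply: (le_trans (pmean_close q_pdf q_supp lam tau0 x)).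
(* What remains is [(eps / 2)^2 + (D + eps / 2)^2 <= (D + eps)^2]. *)
apply: (@le_trans _ _ (tau * - ln L + S ^+ 2)).
  have := ler_wpM2l (ltW tau0) lng.
  by rewrite mulrDr (mulrC tau (_ / tau)) divfK ?gt_eqF.
have : S ^+ 2 <= (D + eps / 2) ^+ 2.
  by rewrite ler_pXn2r ?nnegrE//; lra.
have := mulr_ge0 D0 (ltW e0); have := sqr_ge0 eps; lra.
Qed.

End laplace_lower_bound.

(** * Coordinates of a standard Gaussian vector *)

Section gaussian_coordinates.
Context (R : realType).
Local Notation leb := (@lebesgue_measure R).

(** Tonelli, one coordinate at a time, along the recursive construction of [lebesgue_rV]. *)
Lemma integral_prod_lebesgue_rV n (f : 'I_n -> R -> R) :
  (forall i, measurable_fun setT (f i)) -> (forall i x, 0 <= f i x) ->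
  (\int[lebesgue_rV n]_z (\prod_i f i (z ord0 i))%:E =
   \prod_i \int[leb]_x (f i x)%:E)%E.
Proof.
elim: n f => [|n IH] f mf f0.
  rewrite big_ord0 /=; under eq_integral do rewrite big_ord0.
  by rewrite integral_cst//= diracT mule1.
have mprod m (g : 'I_m -> R -> R) : (forall i, measurable_fun setT (g i)) ->
    measurable_fun setT (fun z : 'rV[R]_m => (\prod_i g i (z ord0 i))%:E).
  move=> mg; apply/measurable_EFinP; apply: measurable_prod => i _.
  exact: (measurableT_comp (mg i) (measurable_rV_coord i)).
have prod0 m (g : 'I_m -> R -> R) (z : 'rV[R]_m) : (forall i x, 0 <= g i x) ->
    (0 <= (\prod_i g i (z ord0 i))%:E)%E.
  by move=> g0; rewrite lee_fin prodr_ge0.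
rewrite /= /lebesgue_rV_step ge0_integral_pushforward//=; last 2 first.
- exact: mprod.
- by move=> z _; exact: prod0.
rewrite preimage_setT.
pose G (z : 'rV[R]_n) := \prod_(i < n) f (lift ord0 i) (z ord0 i).
have E1 (z : measurableTypeR R * 'rV[R]_n) :
    (\prod_i f i (rV_cons z ord0 i))%:E = ((f ord0 z.1)%:E * (G z.2)%:E)%E.
  rewrite big_ord_recl rV_cons0 EFinM; congr (_ * _%:E)%E.
  by apply: eq_bigr => i _; rewrite rV_consS.
under eq_integral do rewrite E1.
have G0 z : (0 <= (G z)%:E)%E.
  exact: (prod0 n (fun i => f (lift ord0 i)) z (fun i x => f0 _ x)).
have mG : measurable_fun setT (fun z => (G z)%:E).
  exact: (mprod n (fun i => f (lift ord0 i)) (fun i => mf _)).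
have mf0 : measurable_fun setT (fun x : measurableTypeR R => (f ord0 x)%:E).
  by apply/measurable_EFinP; exact: (mf ord0).
rewrite fubini_tonelli1/=; last 2 first.
- apply: emeasurable_funM.
    by apply: (measurableT_comp mf0); exact: measurable_fst.
  by apply: (measurableT_comp mG); exact: measurable_snd.
- by move=> z; rewrite mule_ge0 ?lee_fin//; exact: G0.
rewrite /fubini_F/=.
have inner x : (\int[lebesgue_rV n]_z ((f ord0 x)%:E * (G z)%:E) =
    (f ord0 x)%:E * \int[lebesgue_rV n]_z (G z)%:E)%E.
  by rewrite ge0_integralZl// lee_fin.
under eq_integral do rewrite inner.
rewrite ge0_integralZr//; last 2 first.
- by move=> x _; rewrite lee_fin.
- by apply: integral_ge0 => z _; exact: G0.
by rewrite big_ord_recl -(IH (fun i => f (lift ord0 i))).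
Qed.

Lemma isotropic_gauss_pdf1E d (z : 'rV[R]_d) :
  isotropic_gauss_pdf 1 z = \prod_(i < d) normal_pdf 0 1 (z ord0 i).
Proof.
rewrite normal_pdfE ?oner_eq0// /isotropic_gauss_pdf /normal_peak /normal_fun.
rewrite big_split/= prodr_const card_ord exprVn -expR_sum; congr (_ * expR _).
  by rewrite mulr1 expr1n mul1r mulr_natl.
rewrite sqr_sqrtr; last by apply: sumr_ge0 => i _; exact: sqr_ge0.
rewrite mulr_suml -sumrN; apply: eq_bigr => i _.
by rewrite subr0 expr1n mulr1 mulNr.
Qed.

Section coordinate.
Context (d : nat) (disp : measure_display) (Omega : measurableType disp).
Context (P : probability Omega R) (X : {RV P >-> 'rV[R]_d}).
Hypothesis gX : standard_gaussian X.

Lemma standard_gaussian_coord i (A : set (measurableTypeR R)) : measurable A ->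
  P [set omega | A (X omega ord0 i)] = normal_prob 0 1 A.
Proof.
move=> mA.
pose B : set 'rV[R]_d := @rV_coord R d i @^-1` A.
have mB : measurable B.
  by rewrite -[X in measurable X]setTI; exact: measurable_rV_coord.
transitivity (distribution P X B); first by [].
rewrite gX// integral_mkcond.
(* The indicator of [A] is put into the factor of coordinate [i]; every other factor integrates to
   one. *)
pose f j x : R := if j == i then \1_A x * normal_pdf 0 1 x else normal_pdf 0 1 x.
transitivity (\int[lebesgue_rV d]_z (\prod_j f j (z ord0 j))%:E)%E.
  apply: eq_integral => z _; rewrite patchE isotropic_gauss_pdf1E.
  rewrite (bigD1 i)//= [in RHS](bigD1 i)//= /f eqxx.
  rewrite [X in (_ * _ * X)%:E](eq_bigr (fun j => normal_pdf 0 1 (z ord0 j))); last first.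
    by move=> j /negbTE ->.
  rewrite indicE; have -> : (z \in B) = (z ord0 i \in A).
    by apply/idP/idP; rewrite !inE.
  by case: ifP => _; rewrite ?mul1r// !mul0r.
rewrite integral_prod_lebesgue_rV; last 2 first.
- move=> j; rewrite /f; case: (j == i); last exact: measurable_normal_pdf.
  by apply: measurable_funM; [exact: (measurable_indic mA)|exact: measurable_normal_pdf].
- by move=> j x; rewrite /f; case: ifP => _; rewrite ?mulr_ge0 ?normal_pdf_ge0.
rewrite (bigD1 i)//= big1 ?mule1; last first.
  by move=> j /negbTE ji; rewrite /f ji integral_normal_pdf.
rewrite /f eqxx /normal_prob [RHS]integral_mkcond; apply: eq_integral => x _.
by rewrite patchE indicE; case: ifP => _; rewrite ?mul1r ?mul0r.
Qed.

Lemma measurable_coordX i : measurable_fun setT (fun omega => X omega ord0 i).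
Proof.
exact: (measurableT_comp (measurable_rV_coord i) (measurable_funP X)).
Qed.

(** The Radon-Nikodym derivative of [normal_prob] equals [normal_pdf] almost everywhere, since both
    have the same integral over every measurable set. *)
Lemma integral_normal_prob (h : R -> \bar R) :
  measurable_fun setT h -> (forall x, 0 <= h x)%E ->
  (\int[normal_prob 0 1]_x h x = \int[leb]_x (h x * (normal_pdf 0 1 x)%:E))%E.
Proof.
move=> mh h0; have dom := @normal_prob_dominates R 0 1.
rewrite -(Radon_Nikodym_SigmaFinite.change_of_variables dom)//.
have intf := Radon_Nikodym_SigmaFinite.f_integrable dom.
apply: ae_eq_integral => //.
- by apply: emeasurable_funM => //; exact: measurable_int intf.
- apply: emeasurable_funM => //; apply/measurable_EFinP.
  exact: measurable_normal_pdf.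
- apply: ae_eqe_mul2l; apply: integral_ae_eq => //.
  + by apply/measurable_EFinP; exact: measurable_normal_pdf.
  + by move=> E _ mE; rewrite -Radon_Nikodym_SigmaFinite.f_integral.
Qed.

Lemma integral_standard_gaussian_coord i (h : R -> \bar R) :
  measurable_fun setT h -> (forall x, 0 <= h x)%E ->
  (\int[P]_omega h (X omega ord0 i) =
   \int[leb]_x (h x * (normal_pdf 0 1 x)%:E))%E.
Proof.
move=> mh h0; rewrite -integral_normal_prob//.
have mXi := measurable_coordX i.
pose Xi : {RV P >-> measurableTypeR R} :=
  @mfun_Sub _ _ _ (measurableTypeR R) _ (mem_set mXi).
rewrite -(ge0_integral_distribution Xi mh h0).
apply: (@eq_measure_integral _ (measurableTypeR R) R setT
  (normal_prob 0 1) (distribution P Xi) h) => A mA _.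
exact: standard_gaussian_coord.
Qed.

(** Since [x^2 <= 4 e^(x^2/4)], half of the Gaussian exponent absorbs the square and leaves the
    shape of the law with variance 2. This is enough for a finite second moment. *)
Lemma sqr_normal_pdf_le (x : R) :
  x ^+ 2 * normal_pdf 0 1 x <=
  4 * normal_peak 1 * (normal_peak (Num.sqrt 2))^-1 * normal_pdf 0 (Num.sqrt 2) x.
Proof.
have s2 : Num.sqrt 2 != 0 :> R by rewrite gt_eqF// sqrtr_gt0.
have pk : normal_peak (Num.sqrt 2) != 0 :> R by rewrite gt_eqF// normal_peak_gt0.
rewrite !normal_pdfE ?oner_eq0//.
set p1 := normal_peak 1; set p2 := normal_peak _ in pk *.
have -> : 4 * p1 * p2^-1 * (p2 * normal_fun 0 (Num.sqrt 2) x) =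
    p1 * (4 * normal_fun 0 (Num.sqrt 2) x) by field.
rewrite mulrCA; apply: ler_wpM2l; first exact: normal_peak_ge0.
rewrite /normal_fun sqr_sqrtr// subr0 expr1n.
have -> : - x ^+ 2 / (1 *+ 2) = - (x ^+ 2 / 4) + - (x ^+ 2 / 4).
  by rewrite mulr2n; field.
have -> : - x ^+ 2 / (2 *+ 2) = - (x ^+ 2 / 4) by rewrite mulr2n; field.
rewrite expRD mulrA; apply: ler_wpM2r; first exact: expR_ge0.
rewrite expRN ler_pdivrMr ?expR_gt0//.
by have := expR_ge1Dx (x ^+ 2 / 4); lra.
Qed.

Lemma gaussian_coord_sqr i :
  (\int[P]_omega ((X omega ord0 i) ^+ 2)%:E <=
   (4 * normal_peak 1 * (normal_peak (Num.sqrt 2))^-1)%:E)%E.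
Proof.
set C : R := 4 * _ * _.
have C0 : 0 <= C by rewrite !mulr_ge0 ?invr_ge0 ?normal_peak_ge0.
have mh : measurable_fun setT (fun x : R => (x ^+ 2)%:E).
  by apply/measurable_EFinP; exact: measurable_funX.
rewrite (integral_standard_gaussian_coord i mh) => [|x]; last by rewrite lee_fin sqr_ge0.
rewrite -[leRHS]mule1 -(@integral_normal_pdf R 0 (Num.sqrt 2)).
have mpdf m s : measurable_fun setT (fun x : measurableTypeR R => (normal_pdf m s x)%:E).
  by apply/measurable_EFinP; exact: measurable_normal_pdf.
rewrite -ge0_integralZl//; last first.
  by move=> x _; rewrite lee_fin normal_pdf_ge0.
apply: ge0_le_integral => //=.
- by move=> x _; rewrite lee_fin mulr_ge0 ?sqr_ge0 ?normal_pdf_ge0.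
- exact: emeasurable_funM.
- exact: measurable_funeM.
- by move=> x _; rewrite lee_fin; exact: sqr_normal_pdf_le.
Qed.

Lemma ge0_integral_opp (h : R -> \bar R) :
  measurable_fun setT h -> (forall x, 0 <= h x)%E ->
  (\int[leb]_x h x = \int[leb]_x h (- x)%R)%E.
Proof.
move=> mh h0.
have -> : (\int[leb]_x h (- x)%R =
  \int[leb]_(x in ((-%R : _ -> measurableTypeR R) @^-1` setT)) (h \o -%R) x)%E.
  by rewrite preimage_setT.
rewrite -ge0_integral_pushforward//.
by apply: eq_measure_integral => //= A mA AS; exact/esym/lebesgue_measureN.
Qed.

(** Integrability follows from [|x| <= 1 + x^2]; the mean vanishes because reflection exchanges the
    positive and negative parts. *)
Lemma gaussian_coord_mean i :
  P.-integrable setT (fun omega => (X omega ord0 i)%:E) /\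
  (\int[P]_omega (X omega ord0 i)%:E = 0)%E.
Proof.
have mXi : measurable_fun setT (fun omega => (X omega ord0 i)%:E).
  by apply/measurable_EFinP; exact: measurable_coordX.
have mX2 : measurable_fun setT (fun omega => ((X omega ord0 i) ^+ 2)%:E).
  by apply/measurable_EFinP; apply: measurable_funX; exact: measurable_coordX.
have intX : P.-integrable setT (fun omega => (X omega ord0 i)%:E).
  apply: (@le_integrable _ _ _ P setT measurableT _
    (fun omega => 1%:E + ((X omega ord0 i) ^+ 2)%:E)%E) => //.
    move=> omega _; rewrite /= lee_fin [leRHS]ger0_norm ?addr_ge0 ?sqr_ge0//.
    have := real_normK (num_real (X omega ord0 i)).
    have := sqr_ge0 (`|X omega ord0 i| - 2^-1); nra.
  apply: integrableD => //; first exact: finite_measure_integrable_cst.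
  apply/integrableP; split => //.
  under eq_integral do rewrite gee0_abs ?lee_fin ?sqr_ge0//.
  exact: le_lt_trans (gaussian_coord_sqr i) (ltry _).
split => //.
pose hp (x : R) := (Num.max x 0)%:E; pose hm (x : R) := (Num.max (- x) 0)%:E.
have mhp : measurable_fun setT hp.
  by apply/measurable_EFinP; exact: measurable_maxr.
have mhm : measurable_fun setT hm.
  by apply/measurable_EFinP; apply: measurable_maxr => //; exact: measurable_oppr.
have hp0 x : (0 <= hp x)%E by rewrite lee_fin le_max lexx orbT.
have hm0 x : (0 <= hm x)%E by rewrite lee_fin le_max lexx orbT.
have mpdf m s : measurable_fun setT (fun x : measurableTypeR R => (normal_pdf m s x)%:E).
  by apply/measurable_EFinP; exact: measurable_normal_pdf.
rewrite integralE.
have -> : (\int[P]_omega (fun omega => (X omega ord0 i)%:E)^\- omega =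
          \int[P]_omega hm (X omega ord0 i))%E.
  by apply: eq_integral => omega _; rewrite funenegE /hm EFin_max.
have pE : (\int[P]_omega (fun omega => (X omega ord0 i)%:E)^\+ omega =
          \int[P]_omega hp (X omega ord0 i))%E.
  by apply: eq_integral => omega _; rewrite funeposE /hp EFin_max.
have fin : (\int[P]_omega hp (X omega ord0 i))%E \is a fin_num.
  by rewrite -pE; apply: integrable_pos_fin_num.
rewrite pE; have -> : (\int[P]_omega hm (X omega ord0 i) =
    \int[P]_omega hp (X omega ord0 i))%E; last by rewrite subee.
rewrite !integral_standard_gaussian_coord// ge0_integral_opp; last 2 first.
- exact: (@emeasurable_funM _ (measurableTypeR R) R setT hm _ mhm (mpdf 0 1)).
- by move=> x; rewrite mule_ge0// lee_fin normal_pdf_ge0.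
apply: eq_integral => x _; rewrite /hm /hp opprK; congr (_ * _%:E)%E.
by rewrite !normal_pdfE ?oner_eq0// /normal_fun !subr0 sqrrN.
Qed.

End coordinate.
End gaussian_coordinates.

(** * Kolmogorov's convergence theorem *)

Section independent_product.
Context (R : realType) (disp : measure_display) (Omega : measurableType disp).
Context (P : probability Omega R).

(** Independence makes the joint law the product of the marginals, by uniqueness on rectangles;
    Fubini then gives an inner integral [y * E X = 0]. Boundedness of [Y] makes the product
    integrable. *)
Lemma integral_indep_mul0 (Y X : Omega -> R) (B : R) :
  measurable_fun setT Y -> measurable_fun setT X ->
  (forall omega, `|Y omega| <= B) ->
  P.-integrable setT (EFin \o X) -> (\int[P]_omega (X omega)%:E = 0)%E ->
  (forall A1 A2 : set R, measurable A1 -> measurable A2 ->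
    P (Y @^-1` A1 `&` X @^-1` A2) = (P (Y @^-1` A1) * P (X @^-1` A2))%E) ->
  P.-integrable setT (fun omega => (Y omega * X omega)%:E) /\
  (\int[P]_omega (Y omega * X omega)%:E = 0)%E.
Proof.
move=> mY mX YB intX X0 indep.
have intYX : P.-integrable setT (fun omega => (Y omega * X omega)%:E).
  apply: (@le_integrable _ _ _ P setT measurableT _
    (fun omega => `|B|%:E * (EFin \o X) omega)%E).
  - by apply/measurable_EFinP; exact: measurable_funM.
  - move=> omega _; rewrite /= lee_fin !normrM normr_id ler_wpM2r//.
    exact: le_trans (YB _) (ler_norm _).
  - exact: integrableZl.
split=> //.
pose Yv : {RV P >-> R} := mfun_Sub (mem_set mY).
pose Xv : {RV P >-> R} := mfun_Sub (mem_set mX).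
have mW : measurable_fun setT (fun omega => (Y omega, X omega)).
  exact: measurable_fun_pair.
pose W : {RV P >-> (R * R)%type} := mfun_Sub (mem_set mW).
have lawW (A : set (R * R)) : measurable A ->
    (distribution P Yv \x distribution P Xv)%E A = distribution P W A.
  apply: product_measure_unique => A1 A2 mA1 mA2.
  by rewrite -indep.
pose f (z : R * R) : \bar R := (z.1 * z.2)%:E.
have mf : measurable_fun setT f.
  apply/measurable_EFinP; apply: measurable_funM.
    exact: measurable_fst.
  exact: measurable_snd.
have intf : (distribution P Yv \x distribution P Xv)%E.-integrable setT f.
  apply/integrableP; split=> //.
  rewrite (@eq_measure_integral _ _ _ _ (distribution P W)); last first.
    by move=> A mA _; exact: lawW.
  rewrite ge0_integral_distribution//; last exact: measurableT_comp.
  by have /integrableP[_] := intYX.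
transitivity (\int[distribution P W]_z f z)%E.
  by rewrite integral_distribution.
rewrite -(@eq_measure_integral _ _ _ _ _ (distribution P Yv \x distribution P Xv)%E); last first.
  by move=> A mA _; exact: lawW.
rewrite -integral12_prod_meas1//.
apply: integral0_eq => y _; rewrite /fubini_F/= /f/=.
have mid : measurable_fun setT (fun x : R => x%:E) by exact/measurable_EFinP.
have intid : (distribution P Xv).-integrable setT (fun x : R => x%:E).
  apply/integrableP; split=> //.
  rewrite ge0_integral_distribution//; last exact: measurableT_comp.
  by have /integrableP[_] := intX.
under eq_integral do rewrite EFinM.
rewrite integralZl// (integral_distribution mid).
  by rewrite [X in (_ * X)%E]X0 mule0.
exact: intX.
Qed.

End independent_product.

Section kolmogorov.
Context (R : realType) (disp : measure_display) (Omega : measurableType disp).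
Context (P : probability Omega R).
Local Notation "G .-meas" := (@measurable_fun _ _ (g_sigma_algebraType G) R setT)
  (at level 2, format "G .-meas").

(** [G n] generates the past strictly before index [n]: [X n] belongs to the past of [n.+1] and is
    independent of that of [n]. *)
Definition independent_increments (G : nat -> set (set Omega))
    (X : nat -> Omega -> R) (v : nat -> R) :=
  [/\ forall n A, <<s G n >> A -> measurable A,
      forall n A, <<s G n >> A -> <<s G n.+1 >> A,
      forall n, (G n.+1).-meas (X n),
      forall n B A, <<s G n >> B -> measurable A ->
        P (B `&` X n @^-1` A) = (P B * P (X n @^-1` A))%E &
      forall n, [/\ P.-integrable setT (EFin \o X n),
        (\int[P]_omega (X n omega)%:E = 0)%E &
        (\int[P]_omega (X n omega ^+ 2)%:E <= (v n)%:E)%E]].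

Section maximal_inequality.
Context (G : nat -> set (set Omega)) (X : nat -> Omega -> R) (v : nat -> R).
Hypothesis GXv : independent_increments G X v.
Variable eps : R.
Hypothesis eps_gt0 : 0 < eps.

Let S n omega := \sum_(k < n) X k omega.

Let small n := [set omega | `]-eps, eps[%classic (S n omega)].

(* [alive n] is the indicator of "no partial sum up to [n] has left ]-eps, eps[";
   [stopped n] is the partial sum stopped at the first exit. *)
Let alive n omega : R := \prod_(k < n.+1) \1_(small k) omega.

Fixpoint stopped n omega : R :=
  if n is m.+1 then stopped m omega + alive m omega * X m omega else 0.

Let past_measurable n (f : Omega -> R) : (G n).-meas f -> measurable_fun setT f.
Proof.
case: GXv => Gm _ _ _ _ mf _ A mA; rewrite setTI; apply: (Gm n).
by have := mf measurableT A mA; rewrite setTI.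
Qed.

Let past_next n (f : Omega -> R) : (G n).-meas f -> (G n.+1).-meas f.
Proof.
case: GXv => _ GS _ _ _ mf _ A mA; rewrite setTI; apply: GS.
by have := mf measurableT A mA; rewrite setTI.
Qed.

Let past_S n : (G n).-meas (S n).
Proof.
elim: n => [|n IH].
  rewrite (_ : S 0%N = cst 0); first exact: measurable_cst.
  by apply/funext => omega; rewrite /S big_ord0.
rewrite (_ : S n.+1 = (S n \+ X n)%R); last first.
  by apply/funext => omega; rewrite /S big_ord_recr.
apply: measurable_funD; first exact: past_next.
by case: GXv.
Qed.

Let past_alive n : (G n).-meas (alive n).
Proof.
have past_small k : (G k).-meas (\1_(small k)).
  apply: measurable_indic; have := @past_S k measurableT _ (measurable_itv `]-eps, eps[).
  by rewrite setTI.
elim: n => [|n IH].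
  rewrite (_ : alive 0%N = \1_(small 0%N)) //.
  by apply/funext => omega; rewrite /alive big_ord1.
rewrite (_ : alive n.+1 = (alive n \* \1_(small n.+1))%R); last first.
  by apply/funext => omega; rewrite /alive big_ord_recr.
by apply: measurable_funM => //; exact: past_next.
Qed.

Let alive01 n omega : alive n omega = 0 \/ alive n omega = 1.
Proof.
rewrite /alive; elim/big_ind: _ => [|x y [->|->] [->|->]|i _].
- by right.
- by left; rewrite mul0r.
- by left; rewrite mul0r.
- by left; rewrite mulr0.
- by right; rewrite mulr1.
- by rewrite indicE; case: (_ \in _); [right|left].
Qed.

Let alive_next n omega : alive n.+1 omega = alive n omega * \1_(small n.+1) omega.
Proof. by rewrite /alive big_ord_recr. Qed.

Let alive_stopped n omega : alive n omega = 1 ->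
  stopped n omega = S n omega /\ `|S n omega| < eps.
Proof.
elim: n => [_|n IH]; first by rewrite /= /S big_ord0 normr0.
rewrite alive_next => an.
have [a0|a1] := alive01 n omega; first by move: an; rewrite a0 mul0r => /esym/eqP; rewrite oner_eq0.
have [TS _] := IH a1; split.
  by rewrite /= TS a1 mul1r /S big_ord_recr.
move: an; rewrite a1 mul1r indicE; case: (boolP (omega \in small n.+1)) => [|_].
  by rewrite inE /small/= in_itv/= ltr_norml.
by move=> /esym/eqP; rewrite oner_eq0.
Qed.

(** The stopped sum is frozen at the first exit, where it equals the partial sum that has just left
    the interval. *)
Let dead_stopped n omega : alive n omega = 0 -> eps <= `|stopped n omega|.
Proof.
elim: n => [|n IH].
  have s0 : small 0%N omega.
    by rewrite /small/= /S big_ord0 in_itv/= oppr_lt0 eps_gt0.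
  by rewrite /alive big_ord1 indicE mem_set// => /eqP; rewrite oner_eq0.
rewrite alive_next => an.
have [a0|a1] := alive01 n omega.
  by rewrite /= a0 mul0r addr0; exact: IH.
have [TS _] := alive_stopped a1.
have -> : stopped n.+1 omega = S n.+1 omega.
  by rewrite /= TS a1 mul1r /S big_ord_recr.
move: an; rewrite a1 mul1r indicE; case: (boolP (omega \in small n.+1)) => [_|].
  by move=> /eqP; rewrite oner_eq0.
by rewrite notin_setE /small/= in_itv/= -ltr_norml => /negP; rewrite -leNgt.
Qed.

Let alive_exit n k omega : (k <= n)%N -> eps <= `|S k omega| -> alive n omega = 0.
Proof.
move=> kn Sk; have [//|a1] := alive01 n omega.
have : alive k omega = 1.
  elim: n kn a1 => [|n IH]; first by rewrite leqn0 => /eqP ->.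
  rewrite leq_eqVlt => /orP[/eqP ->//|kn]; rewrite alive_next => a1.
  apply: IH => //; have [a0|//] := alive01 n omega.
  by move: a1; rewrite a0 mul0r => /esym/eqP; rewrite oner_eq0.
by move=> /alive_stopped[_]; rewrite ltNge Sk.
Qed.

Let measurable_stopped n : measurable_fun setT (stopped n).
Proof.
elim: n => [|n IH]; first exact: measurable_cst.
apply: measurable_funD => //; apply: measurable_funM.
  exact: (@past_measurable n _ (@past_alive n)).
by case: GXv => _ _ /(_ n) mX _ _; exact: (@past_measurable n.+1 _ mX).
Qed.

(** The cross term is [2 * Y * X n] with [Y = alive n * S n]. [Y] depends on the past alone and is
    bounded by [eps], because being alive forces [|S n| < eps]; so the cross term has mean zero. *)
Lemma stopped_second_moment n :
  P.-integrable setT (fun omega => (stopped n omega ^+ 2)%:E) /\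
  (\int[P]_omega (stopped n omega ^+ 2)%:E <= (\sum_(k < n) v k)%:E)%E.
Proof.
elim: n => [|n [intT IH]].
  rewrite big_ord0 /=; under eq_fun do rewrite expr0n.
  by split; [exact: integrable0|rewrite integral0].
case: GXv => _ _ mX indep /(_ n)[intX X0 Xv].
have mXn : measurable_fun setT (X n) := @past_measurable n.+1 _ (mX n).
have man := @past_measurable n _ (@past_alive n).
pose Y omega := alive n omega * S n omega.
have pY : (G n).-meas Y by exact: measurable_funM.
have Yeps omega : `|Y omega| <= eps.
  rewrite /Y; have [->|a1] := alive01 n omega.
    by rewrite mul0r normr0 ltW.
  by rewrite a1 mul1r; have [_ /ltW] := alive_stopped a1.
have indepY (A1 A2 : set R) : measurable A1 -> measurable A2 ->
    P (Y @^-1` A1 `&` X n @^-1` A2) = (P (Y @^-1` A1) * P (X n @^-1` A2))%E.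
  move=> mA1 mA2; apply: indep => //.
  by have := pY measurableT A1 mA1; rewrite setTI.
have [intYX YX0] := integral_indep_mul0 (@past_measurable n _ pY) mXn Yeps intX X0
  indepY.
have intX2 : P.-integrable setT (fun omega => (X n omega ^+ 2)%:E).
  apply/integrableP; split.
    by apply/measurable_EFinP; exact: measurable_funX.
  under eq_integral do rewrite gee0_abs ?lee_fin ?sqr_ge0//.
  exact: le_lt_trans Xv (ltry _).
have aX2 omega : 0 <= alive n omega * X n omega ^+ 2 <= X n omega ^+ 2.
  by have [->|->] := alive01 n omega; rewrite ?mul0r ?mul1r lexx sqr_ge0.
have maX2 : measurable_fun setT (fun omega => (alive n omega * X n omega ^+ 2)%:E).
  by apply/measurable_EFinP; apply: measurable_funM => //; exact: measurable_funX.
have intaX2 : P.-integrable setT (fun omega => (alive n omega * X n omega ^+ 2)%:E).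
  apply: le_integrable intX2 => // omega _; have /andP[h1 h2] := aX2 omega.
  by rewrite /= lee_fin !ger0_norm// sqr_ge0.
have TE omega : (stopped n.+1 omega ^+ 2)%:E = ((stopped n omega ^+ 2)%:E
    + (2%:E * (Y omega * X n omega)%:E + (alive n omega * X n omega ^+ 2)%:E))%E.
  rewrite /Y -EFinM -!EFinD /=; congr EFin.
  have [->|a1] := alive01 n omega; first by ring.
  by have [-> _] := alive_stopped a1; rewrite a1; ring.
have int2 : P.-integrable setT (fun omega => 2%:E * (Y omega * X n omega)%:E)%E.
  exact: integrableZl.
have int3 := integrableD measurableT int2 intaX2.
split.
  under eq_fun do rewrite TE.
  exact: integrableD.
under eq_integral do rewrite TE.
rewrite integralD// integralD// integralZl// YX0 mule0 add0e big_ord_recr/= EFinD.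
apply: leeD => //; apply: le_trans Xv; apply: ge0_le_integral => //.
- by move=> omega _; rewrite lee_fin; case/andP: (aX2 omega).
- by apply/measurable_EFinP; exact: measurable_funX.
- by move=> omega _; rewrite lee_fin; case/andP: (aX2 omega).
Qed.

Definition exits n : set Omega :=
  [set omega | exists2 k, (k <= n)%N & eps <= `|\sum_(j < k) X j omega|].

Lemma measurable_exits n : measurable (exits n).
Proof.
have -> : exits n = \bigcup_(k in [set k | (k <= n)%N])
    ((fun omega => `|S k omega|) @^-1` `[eps, +oo[%classic).
  apply/seteqP; split => omega [k kn /= h]; exists k => //=.
    by rewrite in_itv/= andbT.
  by move: h; rewrite in_itv/= andbT.
apply: bigcup_measurable => k _; rewrite -[X in measurable X]setTI.
have mS : measurable_fun setT (fun omega => `|S k omega|).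
  by apply: measurableT_comp => //; exact: (@past_measurable k _ (@past_S k)).
by apply: mS => //; exact: measurable_itv.
Qed.

(** Chebyshev's inequality for the stopped sum at time [n], which is at least [eps] in absolute
    value after any exit. *)
Lemma kolmogorov_maximal n :
  (P (exits n) <= ((\sum_(k < n) v k) / eps ^+ 2)%:E)%E.
Proof.
have mT2 : measurable_fun setT (fun omega => (stopped n omega ^+ 2)%:E).
  by apply/measurable_EFinP; exact: measurable_funX.
have mE := measurable_exits n.
have [intT le2] := stopped_second_moment n.
rewrite EFinM lee_pdivlMr ?exprn_gt0//; apply: le_trans le2.
rewrite -[P _]mul1e -integral_cst// muleC -ge0_integralZl//; last first.
  by rewrite lee_fin sqr_ge0.
apply: (@le_trans _ _ (\int[P]_(omega in exits n) (stopped n omega ^+ 2)%:E)%E).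
  apply: ge0_le_integral => //.
  - by move=> omega _; rewrite mule_ge0// lee_fin sqr_ge0.
  - exact: measurable_funTS.
  - move=> omega [k kn /(alive_exit kn)/dead_stopped T].
    rewrite /= mule1 lee_fin -[leRHS]real_normK ?num_real//.
    by rewrite ler_pXn2r ?nnegrE// ltW.
apply: ge0_subset_integral => //.
by move=> omega _; rewrite lee_fin sqr_ge0.
Qed.

End maximal_inequality.
(** The maximal inequality for the sequence started at [n], extended to an infinite horizon by
    continuity from below, bounds the probability of a late oscillation by a multiple of [r n]. *)
Lemma kolmogorov_cvg (G : nat -> set (set Omega)) X v (r : nat -> R) :
  independent_increments G X v ->
  (forall n N, \sum_(k < N) v (n + k)%N <= r n) -> r @ \oo --> (0 : R) ->
  {ae P, forall omega, cvgn (fun n => \sum_(k < n) X k omega)}.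
Proof.
move=> GXv vr r0.
have shift n : independent_increments (fun k => G (n + k)%N)
    (fun k => X (n + k)%N) (fun k => v (n + k)%N).
  case: GXv => h1 h2 h3 h4 h5; split=> [k|k A|k|k|k].
  - exact: h1.
  - by rewrite addnS; exact: h2.
  - by have := h3 (n + k)%N; rewrite addnS.
  - exact: h4.
  - exact: h5.
pose E eps n N := exits (fun k => X (n + k)%N) eps N.
have PE eps n N : 0 < eps -> (P (E eps n N) <= (r n / eps ^+ 2)%:E)%E.
  move=> e0; apply: (le_trans (kolmogorov_maximal (shift n) e0 N)).
  by rewrite lee_fin ler_wpM2r ?invr_ge0 ?sqr_ge0.
have mE eps n N : measurable (E eps n N) by exact: measurable_exits (shift n) _ _.
have mEU eps n : measurable (\bigcup_N E eps n N) by exact: bigcupT_measurable.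
have PEU eps n : 0 < eps -> (P (\bigcup_N E eps n N) <= (r n / eps ^+ 2)%:E)%E.
  move=> e0; have nd : nondecreasing_seq (E eps n).
    move=> N N' NN'; apply/subsetPset => omega [k kN h]; exists k => //.
    exact: leq_trans NN'.
  have cv := @nondecreasing_cvg_mu _ _ _ P _ (mE eps n) (mEU eps n) nd.
  rewrite -(cvg_lim _ cv)//; apply: lime_le; first by apply/cvg_ex; eexists; exact: cv.
  by apply: nearW => N; exact: PE.
(* On [F m] every tail of the series moves by at least [1 / (m + 1)] at some time; outside all the
   [F m] the partial sums are Cauchy. *)
pose F m := \bigcap_n \bigcup_N E (m.+1%:R^-1) n N.
have F0 m : P.-negligible (F m).
  exists (F m); split=> //; first exact: bigcapT_measurable.
  apply/eqP; rewrite eq_le measure_ge0 andbT.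
  have m0 : 0 < m.+1%:R^-1 :> R by rewrite invr_gt0.
  have le n : (P (F m) <= (r n / m.+1%:R^-1 ^+ 2)%:E)%E.
    apply: (le_trans _ (PEU _ n m0)); apply: le_measure; rewrite ?inE//.
      exact: bigcapT_measurable.
    by move=> omega; exact.
  have cv : (r n / m.+1%:R^-1 ^+ 2)%:E @[n --> \oo] --> 0%:E.
    apply: cvg_EFin; first exact: nearW.
    by rewrite -[X in _ --> X](mul0r (m.+1%:R^-1 ^+ 2)^-1); apply: cvgMl.
  rewrite -[leRHS](cvg_lim _ cv)//; apply: lime_ge; first by apply/cvg_ex; eexists; exact: cv.
  exact: nearW.
apply: (negligibleS _ (negligible_bigcup F0)) => omega /= ncv.
apply: contrapT => nF; apply: ncv.
apply: cauchy_cvg; apply: cauchy_exP => e e0.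
have [m _ /(_ m (leqnn m)) me] := near_infty_natSinv_lt (PosNum e0).
have /existsNP[n nU] : ~ forall n, True -> (\bigcup_N E (m.+1%:R^-1) n N) omega.
  by move=> all; apply: nF; exists m.
have {}nU : ~ (\bigcup_N E (m.+1%:R^-1) n N) omega by move=> h; apply: nU.
exists (\sum_(k < n) X k omega), n => // k /= nk.
rewrite /ball/= distrC; apply: le_lt_trans me; rewrite leNgt; apply/negP => h.
apply: nU; exists (k - n)%N => //; exists (k - n)%N => //; apply: ltW.
have split_sum : \sum_(i < k) X i omega =
    \sum_(i < n) X i omega + \sum_(j < k - n) X (n + j)%N omega.
  by rewrite -[in LHS](subnKC nk) big_split_ord.
by move: h; rewrite split_sum addrC addKr.
Qed.

End kolmogorov.

(** * Almost sure convergence of the weighted noise series *)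

Section gaussian_noise_convergence.
Context (R : realType) (d : nat) (disp : measure_display).
Context (Omega : measurableType disp) (P : probability Omega R).
Context (Z : nat -> {RV P >-> 'rV[R]_d}).
Hypothesis gZ : forall k, standard_gaussian (Z k).
Hypothesis iZ : mutually_independent Z.

(** A family stable under intersection that generates the past of the noises, so that measures
    agreeing on it agree on the whole past. *)
Definition past_cylinders n : set (set Omega) :=
  [set B | exists2 A : nat -> set 'rV[R]_d, (forall k, measurable (A k)) &
    B = \bigcap_(k in `I_n) (Z k @^-1` A k)].

Lemma prob_past_cylinder n (A : nat -> set 'rV[R]_d) :
  (forall k, measurable (A k)) ->
  P (\bigcap_(k in `I_n) (Z k @^-1` A k)) = (\prod_(k < n) P (Z k @^-1` A k))%E.
Proof.
move=> mA; pose J := [fset k | k in iota 0 n]%fset.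
have Jn : [set` J] = `I_n.
  by apply/seteqP; split => k /=; rewrite in_fset /= mem_iota add0n.
rewrite -Jn iZ// -(big_mkord xpredT (fun k => P (Z k @^-1` A k))).
apply: perm_big; apply: uniq_perm; [exact: fset_uniq|exact: iota_uniq|].
by move=> k; rewrite /index_iota subn0 in_fset.
Qed.

Lemma measurable_preimageZ k (A : set 'rV[R]_d) : measurable A ->
  measurable (Z k @^-1` A).
Proof.
by move=> mA; rewrite -[X in measurable X]setTI; exact: measurable_funP.
Qed.

Lemma measurable_past_cylinder n B : past_cylinders n B -> measurable B.
Proof.
move=> [A mA ->]; apply: fin_bigcap_measurable; first exact: finite_II.
by move=> k _; exact: measurable_preimageZ.
Qed.

Lemma measurable_past n B : <<s past_cylinders n >> B -> measurable B.
Proof.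
move: B; apply: smallest_sub; first exact: sigma_algebra_measurable.
exact: measurable_past_cylinder.
Qed.

Lemma past_cylinders_next n B : past_cylinders n B -> past_cylinders n.+1 B.
Proof.
move=> [A mA ->]; exists (fun k => if (k < n)%N then A k else setT).
  by move=> k; case: ifP => _ //; exact: measurableT.
apply/seteqP; split => omega h k /= kn.
  by case: ifPn => // kn'; exact: h.
by have := h k (ltn_trans kn (ltnSn n)); rewrite /= kn.
Qed.

Lemma past_cylinder_last n (A : set 'rV[R]_d) : measurable A ->
  past_cylinders n.+1 (Z n @^-1` A).
Proof.
move=> mA; exists (fun k => if k == n then A else setT).
  by move=> k; case: ifP => _ //; exact: measurableT.
apply/seteqP; split => omega /= h.
  by move=> k /= kn; case: eqVneq => // ->.
by have := h n (ltnSn n); rewrite /= eqxx.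
Qed.

Lemma past_cylindersI n : setI_closed (past_cylinders n).
Proof.
move=> _ _ [A mA ->] [B mB ->]; exists (fun k => A k `&` B k).
  by move=> k; exact: measurableI.
by rewrite -bigcapI; apply: eq_bigcapr => k _; rewrite preimage_setI.
Qed.

(** Both sides are finite measures in [B]. They agree on cylinders, where mutual independence
    factors the first [n.+1] noises, hence on the generated sigma-algebra. *)
Lemma past_independent n B (A : set 'rV[R]_d) : <<s past_cylinders n >> B ->
  measurable A -> P (B `&` Z n @^-1` A) = (P B * P (Z n @^-1` A))%E.
Proof.
move=> GB mA; set C := Z n @^-1` A.
have mC : measurable C by exact: measurable_preimageZ.
have PC0 : 0 <= fine (P C) by rewrite fine_ge0.
pose m2 := mscale (NngNum PC0) P.
have cylT : past_cylinders n setT.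
  exists (fun=> setT) => // ; apply/seteqP; split => // omega _ k _ //.
have -> : (P B * P C)%E = m2 B.
  by rewrite /m2 /mscale/= fineK ?fin_num_measure// muleC.
transitivity (mrestr P mC B); first by [].
apply: (g_sigma_algebra_measure_unique (past_cylinders n) _ (fun=> setT)) => //.
- exact: measurable_past_cylinder.
- by rewrite bigcup_const//; exists 0%N.
- exact: past_cylindersI.
- move=> _ [D mD ->]; rewrite /mrestr/= /m2 /mscale/= fineK ?fin_num_measure// muleC.
  rewrite prob_past_cylinder// /C.
  pose D' k := if k == n then A else D k.
  have mD' k : measurable (D' k) by rewrite /D'; case: ifP.
  transitivity (P (\bigcap_(k in `I_n.+1) (Z k @^-1` D' k))).
    congr (P _); apply/seteqP; split => omega.
      move=> [h hA] k /=; rewrite ltnS leq_eqVlt /D' => /orP[/eqP ->|kn].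
        by rewrite eqxx.
      by rewrite ltn_eqF//; exact: h.
    move=> h; split; last by have := h n (ltnSn n); rewrite /= /D' eqxx.
    by move=> k kn; have := h k (ltn_trans kn (ltnSn n)); rewrite /= /D' ltn_eqF.
  rewrite prob_past_cylinder// big_ord_recr/= {2}/D' eqxx; congr (_ * _)%E.
  by apply: eq_bigr => k _; rewrite /D' ltn_eqF.
- move=> k; change (P (setT `&` C) < +oo)%E.
  by rewrite setTI (le_lt_trans (probability_le1 _ mC))// ltry.
Qed.

(** Each coordinate is treated with the past of the whole vectors, and finitely many almost sure
    events are intersected. *)
Lemma gaussian_noise_cvg (c r : nat -> R) :
  (forall n N, \sum_(k < N) c (n + k)%N ^+ 2 <= r n) -> r @ \oo --> (0 : R) ->
  {ae P, forall omega, forall i : 'I_d,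
    cvgn (fun n => \sum_(k < n) c k * Z k omega ord0 i)}.
Proof.
move=> cr r0; apply: filter_forall => i.
pose C : R := 4 * normal_peak 1 * (normal_peak (Num.sqrt 2))^-1.
have C0 : 0 <= C by rewrite !mulr_ge0 ?invr_ge0 ?normal_peak_ge0.
apply: (@kolmogorov_cvg _ _ _ _ past_cylinders
  (fun k omega => c k * Z k omega ord0 i) (fun k => c k ^+ 2 * C) (fun n => r n * C)).
- have mf n : measurable_fun setT (fun z : 'rV[R]_d => c n * z ord0 i).
    by apply: measurable_funM => //; exact: (measurable_rV_coord i).
  split=> [n A|n|n|n B A GB mA|n].
  + exact: measurable_past.
  + apply: smallest_sub; first exact: smallest_sigma_algebra.
    by move=> A /past_cylinders_next GA; exact: sub_sigma_algebra.
  + move=> _ A mA; rewrite setTI; apply: sub_sigma_algebra.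
    have mA' := mf n measurableT A mA; rewrite setTI in mA'.
    exact: (past_cylinder_last n mA').
  + have mA' := mf n measurableT A mA; rewrite setTI in mA'.
    exact: (past_independent GB mA').
  + have [intZ Z0] := gaussian_coord_mean (gZ n) i.
    have Z2 := gaussian_coord_sqr (gZ n) i.
    split.
    * exact: (integrableZl measurableT (c n) intZ).
    * under eq_integral do rewrite EFinM.
      by rewrite integralZl// Z0 mule0.
    * under eq_integral do rewrite exprMn EFinM.
      rewrite ge0_integralZl_EFin ?sqr_ge0//.
      - by rewrite [leRHS]EFinM; apply: lee_wpmul2l => //; rewrite lee_fin sqr_ge0.
      - by move=> omega _; rewrite lee_fin sqr_ge0.
      - apply/measurable_EFinP; apply: measurable_funX; exact: measurable_coordX.
- by move=> n N; rewrite -mulr_suml ler_wpM2r.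
- by rewrite -[X in _ --> X](mul0r C); exact: cvgMl.
Qed.

End gaussian_noise_convergence.

(** * The noised mixture *)

Section noised_mixture_gradient.
Context (R : realType) (d : nat) (I : finType).
Context (w : I -> R) (p : I -> 'rV[R]_d -> R) (M : R).
Hypothesis w_ge0 : forall eta, 0 <= w eta.
Hypothesis w_sum1 : \sum_eta w eta = 1.
Hypothesis p_pdf : forall eta, is_pdf (p eta).
Hypothesis p_supp : forall eta u, p eta u != 0 -> enorm u <= M.

(** Viewed as a single density carried by the same ball, the mixture falls under all the results on
    smoothed densities, just as one component does. *)
Definition mixture u := \sum_eta w eta * p eta u.

Lemma mixture_supp u : mixture u != 0 -> enorm u <= M.
Proof.
move=> mu0; rewrite leNgt; apply/negP => Mu; move/eqP: mu0; apply.
rewrite /mixture big1// => eta _; have [->|/p_supp] := eqVneq (p eta u) 0.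
  by rewrite mulr0.
by rewrite leNgt Mu.
Qed.

Lemma integral_mixture (f : 'rV[R]_d -> R) : admissible M f ->
  (\int[lebesgue_rV d]_u (mixture u * f u)%:E =
   (\sum_eta w eta * qmean (p eta) f)%:E)%E.
Proof.
move=> af.
have ipf eta : (lebesgue_rV d).-integrable setT (fun u => (p eta u * f u)%:E).
  exact: (integrable_qmean (p_pdf eta) (@p_supp eta) af).
under eq_integral do rewrite /mixture mulr_suml -sumEFin.
rewrite integral_sum//=; last first.
  move=> eta; under eq_fun do rewrite -mulrA EFinM.
  exact: integrableZl.
rewrite -sumEFin; apply: eq_bigr => eta _.
under eq_integral do rewrite -mulrA EFinM.
rewrite integralZl// EFinM; congr (_ * _)%E.
by rewrite /qmean /Rintegral fineK//; exact: integrable_fin_num.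
Qed.

Lemma mixture_pdf : is_pdf mixture.
Proof.
split.
- apply: measurable_sum => eta; apply: measurable_funM => //.
  by case: (p_pdf eta).
- move=> u; apply: sumr_ge0 => eta _; rewrite mulr_ge0//.
  exact: pdf_ge0.
- transitivity (\int[lebesgue_rV d]_u (mixture u * (cst 1 u))%:E)%E.
    by apply: eq_integral => u _; rewrite mulr1.
  rewrite (integral_mixture (@admissible_cst R d M 1)); congr EFin.
  rewrite -[RHS]w_sum1; apply: eq_bigr => eta _.
  by rewrite (qmean_cst (p_pdf eta) (@p_supp eta)) mulr1.
Qed.

Lemma gsmooth_mixture lam tau x : 0 < tau ->
  gsmooth mixture lam tau x = \sum_eta w eta * gsmooth (p eta) lam tau x.
Proof.
move=> tau0; rewrite /gsmooth {1}/qmean /Rintegral.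
by rewrite (integral_mixture (@admissible_gker R d M lam tau tau0 x)).
Qed.

Lemma mixture_ge eta u : w eta * p eta u <= mixture u.
Proof.
rewrite /mixture (bigD1 eta)//= lerDl; apply: sumr_ge0 => i _.
by rewrite mulr_ge0//; exact: pdf_ge0.
Qed.

Section time.
Context (t : R).
Hypothesis t_gt0 : 0 < t.

Local Notation lam := (lambda_ t).
Local Notation tau := (2 * sigma_ t ^+ 2).
Local Notation cst_t := ((Num.sqrt (2 * pi) * sigma_ t) ^- d).

Lemma lambda_gt0_lt1 : 0 < lam < 1.
Proof.
by rewrite /lambda_ expR_gt0/= -[ltRHS]expR0 ltr_expR oppr_lt0.
Qed.

Lemma sigma_sqr : sigma_ t ^+ 2 = 1 - lam ^+ 2.
Proof.
rewrite sqr_sqrtr// subr_ge0; have /andP[l0 l1] := lambda_gt0_lt1.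
by rewrite expr_le1 ?ltW.
Qed.

Lemma sigma_gt0 : 0 < sigma_ t.
Proof.
rewrite sqrtr_gt0 subr_gt0; have /andP[l0 l1] := lambda_gt0_lt1.
by rewrite expr_lt1 ?ltW.
Qed.

Lemma tau_gt0 : 0 < tau.
Proof. by rewrite mulr_gt0// exprn_gt0// sigma_gt0. Qed.

Lemma gauss_cst_gt0 : 0 < cst_t.
Proof.
by rewrite invr_gt0 exprn_gt0// mulr_gt0 ?sigma_gt0// sqrtr_gt0 mulr_gt0// pi_gt0.
Qed.

Lemma noised_componentE eta x :
  noised_component p t eta x = cst_t * gsmooth (p eta) lam tau x.
Proof.
rewrite /gsmooth -(qmeanZ (p_pdf eta) (@p_supp eta))//.
exact: (@admissible_gker R d M _ _ tau_gt0 x).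
Qed.

Lemma noised_mixtureE x :
  noised_mixture w p t x = cst_t * gsmooth mixture lam tau x.
Proof.
rewrite gsmooth_mixture ?tau_gt0// mulr_sumr; apply: eq_bigr => eta _.
by rewrite noised_componentE mulrCA.
Qed.

Lemma gradientP (f : 'rV[R]_d -> R) x (g : 'rV[R]_d) :
  (forall i, is_derive x (delta_mx ord0 i) f (g ord0 i)) -> gradient f x = g.
Proof. by move=> df; apply/rowP => i; rewrite mxE; case: (df i). Qed.

Lemma gradient_ln_mixture x :
  gradient (fun y => ln (noised_mixture w p t y)) x =
  - (sigma_ t ^+ 2)^-1 *: (x - lam *: pmean mixture lam tau x).
Proof.
apply: gradientP => i.
have -> : (fun y => ln (noised_mixture w p t y)) =
          (cst (ln cst_t) + (fun y => ln (gsmooth mixture lam tau y))).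
  apply/funext => y; rewrite noised_mixtureE lnM ?posrE ?gauss_cst_gt0//.
  exact: (gsmooth_gt0 mixture_pdf mixture_supp _ tau_gt0).
have := is_derive_ln_gsmooth lam mixture_pdf mixture_supp tau_gt0 x i.
move=> dg; apply: is_derive_eq; rewrite add0r !mxE.
by field; rewrite gt_eqF ?sigma_gt0.
Qed.

(** The Gaussian constant cancels in the quotient, and [w eta > 0] allows its logarithm to split off
    as a constant. *)
Lemma gradient_ln_posterior eta x : 0 < w eta ->
  gradient (fun y => ln (noised_posterior w p t eta y)) x =
  - (sigma_ t ^+ 2)^-1 *: (x - lam *: pmean (p eta) lam tau x) +
  (sigma_ t ^+ 2)^-1 *: (x - lam *: pmean mixture lam tau x).
Proof.
move=> weta; apply: gradientP => i.
have -> : (fun y => ln (noised_posterior w p t eta y)) =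
          (cst (ln (w eta)) + (fun y => ln (gsmooth (p eta) lam tau y))
            - (fun y => ln (gsmooth mixture lam tau y))).
  apply/funext => y; rewrite /noised_posterior noised_mixtureE noised_componentE.
  have g0 := gsmooth_gt0 (p_pdf eta) (@p_supp eta) lam tau_gt0 y.
  have gm0 := gsmooth_gt0 mixture_pdf mixture_supp lam tau_gt0 y.
  have c0 := gauss_cst_gt0.
  have -> : w eta * (cst_t * gsmooth (p eta) lam tau y) /
      (cst_t * gsmooth mixture lam tau y) =
      w eta * gsmooth (p eta) lam tau y / gsmooth mixture lam tau y.
    by rewrite [w eta * _]mulrCA -mulf_div divff ?gt_eqF// mul1r.
  by rewrite ln_div ?posrE ?mulr_gt0// lnM.
have d1 := is_derive_ln_gsmooth lam mixture_pdf mixture_supp tau_gt0 x i.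
have d2 := is_derive_ln_gsmooth lam (p_pdf eta) (@p_supp eta) tau_gt0 x i.
apply: is_derive_eq; rewrite add0r !mxE.
by field; rewrite gt_eqF ?sigma_gt0.
Qed.

End time.
End noised_mixture_gradient.

(** * Elementary bounds on the rates and the noise variances *)

Section step_sizes.
Context (R : realType).
Implicit Types s Delta kappa : R.

Lemma expR_sub1_le Delta : expR Delta - 1 <= Delta * expR Delta.
Proof.
have := expR_ge1Dx (- Delta); rewrite expRN => h.
have e0 := expR_gt0 Delta.
have := ler_wpM2r (ltW e0) h; rewrite mulVf ?gt_eqF//; lra.
Qed.

(** With [v = min(1, s)], the numerator is at most [2 kappa v e] and [sigma_ s ^+ 2 = 1 - e^(-2s)]
    is at least [2 v e^-2]; the quotient is [kappa e^3]. *)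
Lemma rate_le kappa s Delta : 0 < Delta -> Delta < s -> 0 < kappa < 1 ->
  Delta <= kappa * Num.min 1 (s - Delta) ->
  2 * (expR Delta - 1) / sigma_ s ^+ 2 <= kappa * expR 3.
Proof.
move=> D0 Ds /andP[k0 k1] hD.
have s0 : 0 < s := lt_trans D0 Ds.
rewrite ler_pdivrMr ?exprn_gt0 ?sigma_gt0//.
pose v := Num.min 1 s.
have v1 : v <= 1 by rewrite ge_min lexx.
have v0 : 0 < v by rewrite lt_min ltr01.
have Dv : Delta <= kappa * v.
  apply: (le_trans hD); apply: ler_wpM2l; first exact: ltW.
  by apply: le_min2 => //; rewrite lerBlDr lerDl ltW.
have D1 : Delta <= 1.
  by apply: (le_trans Dv); rewrite mulr_ile1 ?(ltW k0) ?(ltW k1) ?(ltW v0).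
have h1 : expR Delta - 1 <= Delta * expR 1.
  apply: (le_trans (expR_sub1_le _)).
  by rewrite ler_wpM2l ?(ltW D0)// ler_expR.
have h2 : 2 * v * expR (- 2) <= sigma_ s ^+ 2.
  rewrite sigma_sqr// /lambda_ expr2 -expRD.
  apply: (@le_trans _ _ (1 - expR (- (2 * v)))); last first.
    rewrite lerD2l lerN2 ler_expR; have : v <= s by rewrite ge_min lexx orbT.
    lra.
  have -> : 1 - expR (- (2 * v)) = (expR (2 * v) - 1) * expR (- (2 * v)).
    by rewrite mulrBl -expRD subrr expR0 mul1r.
  apply: ler_pM; rewrite ?expR_ge0 ?mulr_ge0 ?(ltW v0)//.
    by have := expR_ge1Dx (2 * v); lra.
  by rewrite ler_expR; lra.
have e3 : expR 3 = expR 1 * expR 2 :> R by rewrite -expRD; congr expR; lra.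
have e2 : expR 2 * expR (- 2) = 1 :> R by rewrite -expRD subrr expR0.
have p1 : 0 <= kappa * expR 3 by rewrite mulr_ge0 ?expR_ge0// ltW.
apply: le_trans (ler_wpM2l p1 h2).
have -> : kappa * expR 3 * (2 * v * expR (- 2)) =
    2 * (kappa * v * expR 1) * (expR 2 * expR (- 2)) by rewrite e3; ring.
rewrite e2 mulr1 ler_pM2l//; apply: (le_trans h1).
by rewrite ler_wpM2r ?expR_ge0.
Qed.

(** From [e^Delta - 1 >= Delta] and [sigma_ s ^+ 2 <= 2 s], the factors 2 cancelling. *)
Lemma rate_ge s Delta : 0 < Delta -> Delta < s ->
  Delta / s <= 2 * (expR Delta - 1) / sigma_ s ^+ 2.
Proof.
move=> D0 Ds; have s0 : 0 < s := lt_trans D0 Ds.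
rewrite ler_pdivlMr ?exprn_gt0 ?sigma_gt0// mulrAC ler_pdivrMr//.
have h1 : Delta <= expR Delta - 1 by have := expR_ge1Dx Delta; lra.
have h2 : sigma_ s ^+ 2 <= 2 * s.
  rewrite sigma_sqr// /lambda_ expr2 -expRD.
  by have := expR_ge1Dx (- s - s); lra.
have := ler_wpM2l (ltW D0) h2.
have := ler_wpM2r (ltW s0) h1; lra.
Qed.

(** Linearity in [Delta] is the point: sums of variances telescope to a multiple of the remaining
    time. *)
Lemma noise_variance_le Delta : 0 <= Delta -> Delta <= 1 ->
  Num.sqrt (expR (2 * Delta) - 1) ^+ 2 <= 2 * expR 2 * Delta.
Proof.
move=> D0 D1; rewrite sqr_sqrtr; last first.
  by have := expR_ge1Dx (2 * Delta); lra.
apply: (le_trans (expR_sub1_le _)).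
have e2 : expR (2 * Delta) <= expR 2 by rewrite ler_expR; lra.
by have := ler_wpM2l D0 e2; lra.
Qed.

End step_sizes.

Lemma compact_enorm_bounded (R : realType) (d : nat) (K : set 'rV[R]_d) :
  compact K -> exists2 M : R, 0 <= M & forall z, K z -> enorm z <= M.
Proof.
move=> cK; have [K0|/set0P/negP/negPn/eqP->] := pselect (K !=set0); last by exists 0.
have [|c cin hc] := @EVT_max_rV _ _ (@enorm R d) _ K0 cK.
  exact: continuous_subspaceT (@continuous_enorm R d).
exists (enorm c); first exact: enorm_ge0.
by move=> z Kz; apply: hc; rewrite inE.
Qed.

Lemma enorm_cvg0 (R : realType) (d : nat) (u : nat -> 'rV[R]_d) :
  (forall i, u n ord0 i @[n --> \oo] --> (0 : R)) ->
  enorm (u n) @[n --> \oo] --> (0 : R).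
Proof.
move=> hu.
have : \sum_(i < d) `|u n ord0 i| @[n --> \oo] --> \sum_(i < d) `|0 : R|.
  apply: (@cvg_big R^o 'I_d +%R 0 predT) => [|i _].
    exact: (@add_continuous R^o).
  exact: cvg_norm (hu i).
rewrite normr0 big1// => sum0.
apply: (@squeeze_cvgr _ _ _ _ (cst 0) _ _ _ _ _ sum0); last exact: cvg_cst.
by apply: nearW => n; rewrite enorm_ge0 enorm_le_sum.
Qed.

Theorem theorem4p2 (R : realType) (d : nat) (I : finType) (eta0 : I)
    (w : I -> R) (p : I -> 'rV[R]_d -> R) (K : I -> set 'rV[R]_d)
    (T gamma : R)
    (d_gt0 : (0 < d)%N)
    (w_ge0 : forall eta, 0 <= w eta)
    (w_sum1 : \sum_eta w eta = 1)
    (w_eta0_gt0 : 0 < w eta0)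
    (p_pdf : forall eta, is_pdf (p eta))
    (p_supp : forall eta u, ~ K eta u -> p eta u = 0)
    (K_convex : forall eta, convex_set (K eta))
    (K_compact : forall eta, compact (K eta))
    (K_interior : forall eta, (K eta)° !=set0)
    (K_disjoint : forall eta eta', eta != eta' -> K eta `&` K eta' = set0)
    (p_eta0_inf : 0 < inf (p eta0 @` K eta0))
    (T_gt0 : 0 < T)
    (gamma_ge1 : 1 <= gamma) :
  exists2 kappa0 : R, 0 < kappa0 &
  forall kappa : R, 0 < kappa < 1 -> kappa <= kappa0 ->
  forall t : nat -> R, t 0%N = 0 ->
    (forall k, 0 <= t k) -> (forall k, t k < t k.+1) ->
    (forall k, t k.+1 < T) -> t @ \oo --> T ->
    (forall k, t k.+1 - t k <= kappa * Num.min 1 (T - t k.+1)) ->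
  forall (x0 : 'rV[R]_d)
    (disp : measure_display) (Omega : measurableType disp)
    (P : probability Omega R) (Z : nat -> {RV P >-> 'rV[R]_d})
    (xhat : nat -> Omega -> 'rV[R]_d),
    (forall k, standard_gaussian (Z k)) -> mutually_independent Z ->
    (forall omega, xhat 0%N omega = x0) ->
    (forall k omega,
      let Delta := t k.+1 - t k in
      let x := xhat k omega in
      xhat k.+1 omega =
        expR Delta *: x
        + (2 * (expR Delta - 1)) *:
          (gradient (fun y => ln (noised_mixture w p (T - t k) y)) x
           + gamma *:
             gradient (fun y => ln (noised_posterior w p (T - t k) eta0 y)) x)
        + Num.sqrt (expR (2 * Delta) - 1) *: Z k omega) ->
  {ae P, forall omega,
    dist_set (xhat k omega) (K eta0) @[k --> \oo] --> (0 : R)}.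
Proof.
have [B B0 KB] : exists2 B : I -> R, (forall eta, 0 <= B eta) &
    forall eta z, K eta z -> enorm z <= B eta.
  have hB eta : exists M : R, 0 <= M /\ forall z, K eta z -> enorm z <= M.
    by have [M M0 KM] := compact_enorm_bounded (K_compact eta); exists M.
  by have [B hB'] := choice hB; exists B => eta; case: (hB' eta).
pose M := \sum_eta B eta.
have KM eta z : K eta z -> enorm z <= M.
  move=> /KB zB; apply: (le_trans zB); rewrite /M (bigD1 eta)//= lerDl.
  exact: sumr_ge0.
have pK eta u : p eta u != 0 -> K eta u.
  by move=> pu; apply: contrapT => /p_supp pu0; move: pu; rewrite pu0 eqxx.
have pM eta u : p eta u != 0 -> enorm u <= M by move=> /pK/KM.
have mpdf := mixture_pdf w_ge0 w_sum1 p_pdf pM.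
have msupp : forall u, mixture w p u != 0 -> enorm u <= M := mixture_supp pM.
pose rho := inf (p eta0 @` K eta0).
have p_rho z : K eta0 z -> rho <= p eta0 z.
  move=> Kz; apply: ge_inf; last by exists z.
  by exists 0 => _ [u _ <-]; exact: pdf_ge0.
have m_rho z : K eta0 z -> w eta0 * rho <= mixture w p z.
  move=> /p_rho pz; apply: le_trans (mixture_ge w_ge0 p_pdf eta0 z).
  by rewrite ler_wpM2l.
have wrho : 0 < w eta0 * rho by rewrite mulr_gt0.
have close0 := pmean_close_unif (p_pdf eta0) (pM eta0) (K_convex eta0)
  (K_interior eta0) (KM eta0) p_eta0_inf p_rho.
(* The mixture is bounded below by [w eta0 * rho] on [K eta0], so it is close to the same set as the
   component. *)
have closem := pmean_close_unif mpdf msupp (K_convex eta0)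
  (K_interior eta0) (KM eta0) wrho m_rho.
have g2 : 0 < 32 * gamma ^+ 2.
  by rewrite mulr_gt0// exprn_gt0//; lra.
(* [rate_le] gives [a k <= kappa * expR 3], and the contraction requires
   [32 * gamma ^+ 2 * a k <= 1]. *)
exists (32 * gamma ^+ 2 * expR 3)^-1.
  by rewrite invr_gt0 mulr_gt0// expR_gt0.
move=> kappa k01 kk0 t t0 t_ge0 tS tT tcvg tstep x0 disp Omega P Z xhat gZ iZ xE0 xE.
have /andP[k0 k1] := k01.
pose s k := T - t k.
have tltT k : t k < T by apply: lt_trans (tS k) (tT k).
have s0 k : 0 < s k by rewrite subr_gt0.
pose D k := t k.+1 - t k.
have D0 k : 0 < D k by rewrite subr_gt0.
have sS k : s k - D k = s k.+1 by rewrite /s /D; ring.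
have Ds k : D k < s k by rewrite -subr_gt0 sS.
have Dk k : D k <= kappa * Num.min 1 (s k - D k) by rewrite sS; exact: tstep.
have D1 k : D k <= 1.
  apply: (le_trans (Dk k)); rewrite mulr_ile1 ?(ltW k0) ?(ltW k1) ?ge_min ?lexx//.
  by rewrite le_min ler01 subr_ge0 ltW.
have scvg : s @ \oo --> (0 : R).
  by rewrite -(subrr T); apply: cvgB => //; exact: cvg_cst.
pose c k := Num.sqrt (expR (2 * D k) - 1).
pose r n := 2 * expR 2 * s n.
have cr n N : \sum_(k < N) c (n + k)%N ^+ 2 <= r n.
  apply: (@le_trans _ _ (2 * expR 2 * (s n - s (n + N)%N))); last first.
    by rewrite ler_wpM2l ?mulr_ge0 ?expR_ge0// lerBlDr lerDl ltW.
  elim: N => [|N IH]; first by rewrite big_ord0 addn0 subrr mulr0.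
  rewrite big_ord_recr/=.
  have := noise_variance_le (ltW (D0 (n + N)%N)) (D1 (n + N)%N).
  rewrite -/(c _) => cN; apply: (le_trans (lerD IH cN)).
  by rewrite -mulrDr addnS -sS; apply: ler_wpM2l; rewrite ?mulr_ge0 ?expR_ge0//; lra.
have rcvg : r @ \oo --> (0 : R).
  by rewrite -(mulr0 (2 * expR 2)); exact: cvgMr.
apply: filterS (gaussian_noise_cvg gZ iZ cr rcvg) => omega noise.
pose S n : 'rV[R]_d := \row_i \sum_(k < n) c k * Z k omega ord0 i.
pose Soo : 'rV[R]_d := \row_i limn (fun n => \sum_(k < n) c k * Z k omega ord0 i).
pose x k := xhat k omega.
pose y k := x k + (Soo - S k).
pose lam k := lambda_ (s k).
pose a k := 2 * (expR (D k) - 1) / sigma_ (s k) ^+ 2.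
pose tau k := 2 * sigma_ (s k) ^+ 2.
pose mu0 k := pmean (p eta0) (lam k) (tau k) (x k).
pose mu k := pmean (mixture w p) (lam k) (tau k) (x k).
(* As [expR (D k) - 1 = a k * v k], the dilation by [expR (D k)] becomes a small
   extra drift. *)
pose v k := sigma_ (s k) ^+ 2 / 2.
have sig0 k : 0 < sigma_ (s k) by exact: sigma_gt0.
have lam01 k : 0 < lam k < 1 by exact: lambda_gt0_lt1.
have lamcvg : lam @ \oo --> (1 : R).
  have ns : - s k @[k --> \oo] --> - (0 : R) by exact: cvgN.
  have := @cvg_comp _ _ _ (fun k => - s k) (@expR R) _ _ _ ns (@continuous_expR R (- 0)).
  by rewrite oppr0 expR0.
have sigcvg : (fun k => sigma_ (s k) ^+ 2) @ \oo --> (0 : R).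
  have -> : (fun k => sigma_ (s k) ^+ 2) = (fun k => 1 - lam k * lam k).
    by apply/funext => k; rewrite sigma_sqr// expr2.
  have lam2 : lam k * lam k @[k --> \oo] --> (1 * 1 : R) by exact: cvgM.
  rewrite -(subrr 1) -[X in _ - X](mulr1 (1 : R)).
  exact: (@cvgB _ R^o _ _ _ (cst 1) _ _ _ (cvg_cst _) lam2).
have close (q : 'rV[R]_d -> R) :
    (forall eps, 0 < eps -> exists2 delta, 0 < delta &
      forall l h, 0 < l <= 1 -> 1 - l <= delta -> 0 < h -> h <= delta ->
      forall z P, K eta0 P -> enorm (z - l *: pmean q l h z) <= enorm (z - P) + eps) ->
    forall eps, 0 < eps -> \forall k \near \oo, forall P, K eta0 P ->
      enorm (x k - lam k *: pmean q (lam k) (tau k) (x k)) <= enorm (x k - P) + eps.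
  move=> hq eps e0; have [delta d0 hd] := hq _ e0.
  have d20 : 0 < delta / 2 by rewrite divr_gt0.
  have n1 : \forall k \near \oo, 1 - lam k <= delta.
    have /cvgrPdist_le/(_ _ d0) := lamcvg; apply: filterS => k.
    by apply: le_trans; exact: ler_norm.
  have n2 : \forall k \near \oo, tau k <= delta.
    have /cvgrPdist_le/(_ _ d20) := sigcvg; apply: filterS => k.
    rewrite sub0r normrN => h; rewrite /tau mulrC -ler_pdivlMr//.
    exact: le_trans (ler_norm _) h.
  near=> k; move=> Q KQ; apply: hd => //.
  - by have /andP[-> /ltW] := lam01 k.
  - by near: k.
  - exact: tau_gt0.
  - by near: k.
apply: (@guided_trajectory_cvg R d (K eta0) gamma M x y mu0 mu lam v a s) => //.
- by have [z /interior_subset Kz] := K_interior eta0; exists z.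
- exact: KM.
- by move=> k; have /andP[-> /ltW] := lam01 k.
- by move=> k; rewrite divr_ge0// sqr_ge0.
- by rewrite -(mul0r (2^-1)); apply: cvgMl.
- move=> k; apply: le_trans (rate_ge (D0 k) (Ds k)).
  by rewrite divr_ge0// ltW.
- move=> k; have := rate_le (D0 k) (Ds k) k01 (Dk k); rewrite -/(a k) => ak.
  have := ler_wpM2l (ltW g2) ak => /le_trans; apply.
  rewrite (mulrC kappa) mulrA -ler_pdivlMl ?mulr1//.
  by rewrite mulr_gt0// expR_gt0.
- move=> k; have := rate_ge (D0 k) (Ds k); rewrite -/(a k) => ak.
  have -> : s k.+1 / s k = 1 - D k / s k.
    by rewrite -sS mulrBl divff// gt_eqF.
  by rewrite lerD2l lerN2.
- move=> k; exact: (pmean_enorm (p_pdf eta0) (pM eta0) _ (tau_gt0 (s0 k))).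
(* The obtuse angle is an affine condition on [u], so it passes from the points of [K eta0] to their
   posterior mean. *)
- move=> k z Q zQ; rewrite dotvDr dotvNr subr_le0.
  apply: (pmean_halfspace (p_pdf eta0) (pM eta0) _ (tau_gt0 (s0 k))) => u /pK Ku.
  by have := proj_obtuse (K_convex eta0) zQ Ku; rewrite dotvDr dotvNr subr_le0.
- have -> : (fun k => enorm (x k - y k)) = (fun k => enorm (S k - Soo)).
    by apply/funext => k; congr enorm; rewrite /y opprD opprB addNKr.
  apply: enorm_cvg0 => i.
  have -> : (fun n => (S n - Soo) ord0 i) = (fun n => S n ord0 i - Soo ord0 i).
    by apply/funext => n; rewrite !mxE.
  rewrite -(subrr (Soo ord0 i)); apply: cvgB; last exact: cvg_cst.
  rewrite /S /Soo mxE; under eq_fun do rewrite mxE.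
  exact: noise.
- move=> eps e0.
  apply: filterS2 (close _ close0 _ e0) (close _ closem _ e0) => k c0 cm Q [KQ _].
  by split; [exact: c0|exact: cm].
(* [S k.+1] takes up exactly the noise of step [k], which therefore cancels from [y k.+1]. *)
- move=> k; rewrite /y.
  have -> : S k.+1 = S k + c k *: Z k omega.
    by apply/rowP => i; rewrite !mxE big_ord_recr.
  have -> : x k.+1 = expR (D k) *: x k + (2 * (expR (D k) - 1)) *:
      (- (sigma_ (s k) ^+ 2)^-1 *: (x k - lam k *: mu k) + gamma *:
        (- (sigma_ (s k) ^+ 2)^-1 *: (x k - lam k *: mu0 k) +
         (sigma_ (s k) ^+ 2)^-1 *: (x k - lam k *: mu k))) + c k *: Z k omega.
    rewrite /x xE (gradient_ln_mixture w_ge0 w_sum1 p_pdf pM (s0 k)).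
    by rewrite (gradient_ln_posterior w_ge0 w_sum1 p_pdf pM (s0 k)).
  have sn0 := gt_eqF (sig0 k).
  move: (Z k omega) (x k) (S k) => zk xk Sk.
  move: (mu k) (mu0 k) => mk m0k.
  apply/rowP => i; rewrite /a /v !mxE; field.
  by rewrite sn0.
Unshelve. all: by end_near. Qed.
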